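(* Let $\beta>0$ and $h\in\mathbb C$ with $\operatorname{Re}h>0$. For the partition function $Z_n$ of the Curie--Weiss model we have $$\lim_{n\to\infty}\frac1n\log Z_n(\beta,h)=\lim_{n\to\infty}\frac1n\log Z_n(\beta,-h)=\frac\beta2+h+\log\left(1+e^{2i\zeta_\beta(ih)}\right)-\frac{2\beta}{\left(1+e^{-2i\zeta_\beta(ih)}\right)^2}.$$ Here $\log Z_n(\beta,h)=\log Z_n(\beta,-h)$ denotes the analytic branch on $\{\operatorname{Re}h>0\}$ that is real for real $h>0$, and $\log(1+e^{2i\zeta_\beta(ih)})$ is the principal branch (note $|e^{2i\zeta_\beta(ih)}|<1$).
   Context: The partition function of the Curie--Weiss model at inverse temperature $\beta>0$ and (complex) external field $h$ is $$Z_n(\beta,h)=\sum_{(\sigma_1,\ldots,\sigma_n)\in\{\pm1\}^n}e^{\frac{\beta}{2n}\left(\sum_{k=1}^n\sigma_k\right)^2+h\sum_{k=1}^n\sigma_k}.$$ It satisfies $Z_n(\beta,h)=Z_n(\beta,-h)$, and by the Lee--Yang theorem all its zeroes in $h$ are purely imaginary. The function $\zeta_t$, $t>0$: with $\mathbb H=\{\theta\in\mathbb C:\operatorname{Im}\theta>0\}$, it is known that for every $\theta\in\mathbb H$ the equation $\zeta-t\tan\zeta=\theta$ has a unique (simple) solution $\zeta=\zeta_t(\theta)$ in $\mathbb H$, and $\zeta_t:\mathbb H\to\mathbb H$ is analytic. *)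

(* Defs.v *)
From Stdlib Require Import Reals List ClassicalEpsilon.
From Coquelicot Require Import Coquelicot.
Import ListNotations.
Open Scope R_scope.
Open Scope C_scope.

Definition Cexp (z : C) : C :=
  ((exp (Re z) * cos (Im z))%R, (exp (Re z) * sin (Im z))%R).

Definition Csin (z : C) : C := (Cexp (Ci * z) - Cexp (- (Ci * z))) / (2 * Ci).

Definition Ccos (z : C) : C := (Cexp (Ci * z) + Cexp (- (Ci * z))) / 2.

Definition Ctan (z : C) : C := Csin z / Ccos z.

(* Principal argument, with values in (-PI, PI] for z <> 0. *)
Definition Carg (z : C) : R :=
  if Rle_dec 0 (Im z) then acos (Re z / Cmod z) else (- acos (Re z / Cmod z))%R.

Definition Clog (z : C) : C := (ln (Cmod z), Carg z).

(* All elements of {1, -1}^n, each listed exactly once. *)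
Fixpoint spin_configs (n : nat) : list (list R) :=
  match n with
  | O => [[]]
  | S m => map (cons 1%R) (spin_configs m) ++ map (cons (-1)%R) (spin_configs m)
  end.

Definition Rsum (s : list R) : R := fold_right Rplus 0%R s.

Definition Csum (s : list C) : C := fold_right Cplus (RtoC 0) s.

Definition Zcw (n : nat) (beta : R) (h : C) : C :=
  Csum (map (fun sigma : list R =>
               Cexp (RtoC (beta / (2 * INR n) * (Rsum sigma) ^ 2)%R
                     + h * RtoC (Rsum sigma)))
            (spin_configs n)).

(* L is a holomorphic logarithm of F on the right half-plane, real on the
   positive real axis; for given F, any two such L agree on the half-plane. *)
Definition is_log_branch (F L : C -> C) : Prop :=
  forall h : C, (0 < Re h)%R ->
    @ex_derive C_AbsRing C_NormedModule L h /\
    Cexp (L h) = F h /\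
    (Im h = 0%R -> Im (L h) = 0%R).

(* Definite description: the value is meaningful only where F has such a
   branch, which for F = Zcw n beta is guaranteed by the Lee-Yang theorem. *)
Definition log_branch (F : C -> C) : C -> C :=
  epsilon (inhabits (fun _ : C => RtoC 0)) (is_log_branch F).

Definition is_zeta (t : R) (theta z : C) : Prop :=
  (0 < Im z)%R /\ z - RtoC t * Ctan z = theta.

(* Definite description: the solution exists and is unique when t > 0 and
   Im theta > 0. *)
Definition zeta (t : R) (theta : C) : C :=
  epsilon (inhabits (RtoC 0)) (is_zeta t theta).

(* Main.v *)
Require Import Defs.
From Stdlib Require Import Reals List Lra Lia ClassicalEpsilon.
From Coquelicot Require Import Coquelicot.
From mathcomp Require all_boot all_order all_algebra complex Rstruct ring.
Open Scope R_scope.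
Open Scope C_scope.

(* With w = exp(-2h), the Lee-Yang theorem gives
   Z_n(h) = exp(beta n/2 + n h) prod_j (1 - u_j w) with |u_j| <= 1, so that
   log Z_n is an explicit sum of principal logarithms on Re h > 0 and the mean
   magnetization m_n = (log Z_n)'/n is bounded there together with its
   derivative, uniformly in n, and has nonnegative real part.

   Fixing the value of one spin, with J = beta/n and W the partition function of
   the other n - 1 spins at the same coupling J, gives
   Z_n = e^(J/2) (e^h W(h+J) + e^(-h) W(h-J)); by exchangeability the two terms are
   (1 + m_n)/2 Z_n and (1 - m_n)/2 Z_n. Differentiating this identity shows that
   m_n and the magnetization of W differ by O(1/n), and taking the quotient of the
   two terms shows m_n = tanh(h + beta m_n) + O(1/n), for complex h.

   By the Schwarz-Pick inequality for tanh on the right half-plane, approximate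
   solutions of m = tanh(h + beta m) with Re m >= 0 are close to each other. Hence m_n
   converges to the unique solution m, and zeta_beta(ih) = i (h + beta m).

   Finally (log Z_n)/n minus
   f(h, m_n) = beta/2 + h + log(1 + e^(-2(h + beta m_n))) - beta (1 - m_n)^2/2
   has h-derivative (1 + beta m_n')(m_n - tanh(h + beta m_n)) = O(1/n) and vanishes
   as Re h -> infinity uniformly in n, so it tends to 0. *)

(** * The Lee-Yang step *)

(** For non-real h the Boltzmann weights are complex, so neither convexity nor a variational
    principle is at hand, and errors are controlled through the absence of zeros. The Lee-Yang
    factorization is therefore used for n spins and again, with other inverse roots, for n - 1
    spins. The second system is evaluated at h + J and h - J; this is why estimates for Re h >= a
    rest on bounds valid for Re h >= a/2, with J <= a/2.

    For large beta the map M -> tanh(h + beta M) need not contract the Euclidean distance. At an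
    approximate fixed point, however, beta Re tanh(h + beta M) falls short of Re(h + beta M) by
    about Re h, and these are the two quantities that Schwarz-Pick compares, so two approximate
    fixed points are contracted at every temperature. Existence of the limit then follows from
    completeness, without compactness of families of analytic functions. *)

Definition Cprod (f : C -> C) (u : list C) : C :=
  fold_right (fun x p => Cmult (f x) p) (RtoC 1) u.

Definition in_disc (x : C) : Prop := (Cmod x <= 1)%R.

Module LeeYangStep.
Import all_boot all_order all_algebra complex Rstruct ring.
Import Order.TTheory GRing.Theory Num.Theory.
Local Open Scope ring_scope.

(** If the x are the inverse zeros of the polynomial of n spins, the left side is the polynomial of
    n + 1 spins, with q = e^(-2J): an up spin replaces w by q w; a down spin replaces w by w/q and
    brings the factor w, the powers of q being cleared. For |w| < 1 the Blaschke estimate |q - x w|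
    <= |1 - x q w| makes the second term strictly smaller than the first, so no zero lies in the
    open disc. *)
Lemma lee_yang_polynomial (K : numClosedFieldType) (q : K) (u : seq K) :
  0 <= q -> q < 1 -> (forall x, x \in u -> `|x| <= 1) ->
  exists v : seq K, [/\ size v = (size u).+1, forall x, x \in v -> `|x| <= 1 &
    forall w, \prod_(x <- u) (1 - x * q * w) + w * \prod_(x <- u) (q - x * w)
      = \prod_(x <- v) (1 - x * w)].
Proof.
move=> q0 q1 hu.
pose g : {poly K} := \prod_(x <- u) (1 - (x * q)%:P * 'X)
  + 'X * \prod_(x <- u) (q%:P - x%:P * 'X).
have gE w : g.[w] = \prod_(x <- u) (1 - x * q * w)
    + w * \prod_(x <- u) (q - x * w).
  rewrite /g hornerD hornerM hornerX !horner_prod; congr (_ + _ * _);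
    by apply: eq_bigr => x _; rewrite !hornerE.
have g0 : g.[0] = 1.
  by rewrite gE mul0r addr0 big1 // => x _; rewrite mulr0 subr0.
have gn0 : g != 0 by apply/eqP => e; move: g0; rewrite e horner0 => /eqP;
  rewrite eq_sym oner_eq0.
have lin (a b : K) : (size (a%:P - b%:P * 'X)%R <= 2)%N.
  apply: leq_trans (size_polyD _ _) _; rewrite size_polyN geq_max.
  apply/andP; split; first by apply: leq_trans (size_polyC_leq1 _) _.
  by rewrite mul_polyC; apply: leq_trans (size_scale_leq _ _) _; rewrite size_polyX.
have szp (a b : K -> K) (s : seq K) :
    (size (\prod_(x <- s) ((a x)%:P - (b x)%:P * 'X))%R <= (size s).+1)%N.
  elim: s => [|x s ih]; first by rewrite big_nil size_poly1.
  rewrite big_cons; apply: leq_trans (size_polyMleq _ _) _.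
  rewrite -ltnS; apply: (@leq_trans (2 + (size s).+1).+1.-1); last by [].
  have := leq_add (lin (a x) (b x)) ih.
  set m := (_ + _)%N; case: m => // m.
have szg : (size g <= (size u).+2)%N.
  apply: leq_trans (size_polyD _ _) _; rewrite geq_max; apply/andP; split.
    by apply: leqW; exact: (szp (fun=> 1) (fun x => x * q)).
  apply: leq_trans (size_polyMleq _ _) _; rewrite size_polyX.
  exact: (szp (fun=> q) id).
have [r Dg] := closed_field_poly_normal g.
have lg : lead_coef g != 0 by rewrite lead_coef_eq0.
(* Because |1 - x q w|^2 - |q - x w|^2 = (1 - q^2)(1 - |x w|^2). *)
have key x w : `|x| <= 1 -> `|w| < 1 -> `|q - x * w| <= `|1 - x * q * w|.
  move=> hx hw.
  rewrite -(@ler_pXn2r _ 2) ?nnegrE // !normCK -subr_ge0.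
  have qr : q^* = q by rewrite conj_Creal // ger0_real.
  rewrite !rmorphB !rmorphM /= !conjC1 qr.
  have -> : (1 - x * q * w) * (1 - x^* * q * w^*) - (q - x * w) * (q - x^* * w^*)
    = (1 - q ^+ 2) * (1 - (x * x^*) * (w * w^*)).
    by rewrite !mulrBl !mulrBr !mulr1 !mul1r expr2; ring.
  apply: mulr_ge0; rewrite subr_ge0.
    by rewrite expr_le1 // ltW.
  rewrite -!normCK -exprMn expr_le1 ?mulr_ge0 //.
  by apply: mulr_ile1 => //; apply: ltW.
have rootg w : root g w -> 1 <= `|w|.
  move=> /eqP; rewrite gE => e; rewrite real_leNgt ?normr_real ?real1 //.
  apply/negP => hw.
  have pos x : x \in u -> 0 < `|1 - x * q * w|.
    move=> /hu hx; rewrite normr_gt0 subr_eq0; apply/eqP => e1.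
    have : `|x * q * w| < 1.
      rewrite !normrM (ger0_norm q0) -mulrA.
      apply: le_lt_trans (ler_piMl _ hx) _; first by rewrite mulr_ge0.
      by apply: le_lt_trans (ler_piMl _ (ltW q1)) hw.
    by rewrite -e1 normr1 ltxx.
  have le : `|\prod_(x <- u) (q - x * w)| <= `|\prod_(x <- u) (1 - x * q * w)|.
    rewrite !normr_prod big_seq [X in _ <= X]big_seq; apply: ler_prod => x xu.
    by rewrite normr_ge0 key // hu.
  have lt0 : 0 < `|\prod_(x <- u) (1 - x * q * w)|.
    by rewrite normr_prod big_seq; apply: prodr_gt0 => x /pos.
  move/eqP: e; rewrite addr_eq0 => /eqP e.
  have : `|w| * `|\prod_(x <- u) (q - x * w)| < `|\prod_(x <- u) (1 - x * q * w)|.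
    apply: le_lt_trans (ler_wpM2l (normr_ge0 w) le) _.
    by rewrite gtr_pMl.
  by rewrite e normrN normrM ltxx.
have hr x : x \in r -> 1 <= `|x|.
  move=> xr; apply: rootg; rewrite Dg rootZ //.
  by rewrite root_prod_XsubC.
have rn0 x : x \in r -> x != 0.
  by move=> /hr h; rewrite -normr_gt0; apply: lt_le_trans h.
(* The degree of [g] may be smaller than size u + 1; zeros pad the list, each contributing a factor
   1. *)
exists (map GRing.inv r ++ nseq ((size u).+1 - size r) 0); split.
- rewrite size_cat size_map size_nseq subnKC //.
  have := szg; rewrite Dg size_scale // size_prod_XsubC; exact.
- move=> x; rewrite mem_cat => /orP[/mapP[y yr ->]|].
    by rewrite normfV invf_le1 ?hr // normr_gt0 rn0.
  by rewrite mem_nseq => /andP[_ /eqP->]; rewrite normr0.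
- move=> w; rewrite -gE big_cat /= [X in _ * X]big1_seq; last first.
    by move=> x /andP[_]; rewrite mem_nseq => /andP[_ /eqP->]; rewrite mul0r subr0.
  rewrite mulr1 big_map.
  have E z : g.[z] = lead_coef g * \prod_(x <- r) (z - x).
    rewrite {1}Dg hornerZ horner_prod; congr (_ * _).
    by apply: eq_bigr => x _; rewrite !hornerE.
  have e0 := g0; rewrite E in e0.
  (* Dividing by g(0) = 1 cancels the leading coefficient and turns each factor w - x into 1 -
     w/x. *)
  rewrite E -[LHS]divr1 -[X in _ / X]e0 invfM mulrACA divff // mul1r.
  rewrite -prodfV -big_split /= big_seq [RHS]big_seq; apply: eq_bigr => x xr.
  by rewrite sub0r invrN mulrN mulrBl divff ?rn0 // opprB mulrC.
Qed.

(** * Transfer from [complex R], where polynomials split, to the type [C] *)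

Definition toK (z : C) : complex R := Complex (fst z) (snd z).
Definition ofK (z : complex R) : C := (complex.Re z, complex.Im z).

Lemma toK_inj z w : toK z = toK w -> z = w.
Proof. by case: z => a b; case: w => c d [-> ->]. Qed.

Lemma ofKK z : toK (ofK z) = z.
Proof. by case: z. Qed.

Lemma toK_add z w : toK (Cplus z w) = toK z + toK w.
Proof. by []. Qed.

Lemma toK_mul z w : toK (Cmult z w) = toK z * toK w.
Proof. by []. Qed.

Lemma toK_norm z : `|toK z| = real_complex R (Cmod z).
Proof. by rewrite normc_def /Cmod RsqrtE !RpowE. Qed.

Lemma toK_Cprod (f : C -> C) (g : complex R -> complex R) (u : list C) :
  (forall x, toK (f x) = g (toK x)) ->
  toK (Cprod f u) = \prod_(x <- map toK u) g x.
Proof.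
move=> fg; elim: u => [|x u ih]; first by rewrite big_nil.
by rewrite /= big_cons toK_mul fg ih.
Qed.

Lemma in_disc_toK z : in_disc z <-> `|toK z| <= 1.
Proof.
rewrite toK_norm -[1]/(real_complex R 1) lecR; split; last by move/RleP.
by move=> h; apply/RleP.
Qed.

Lemma Forall_mem (P : C -> Prop) (u : list C) :
  List.Forall P u <-> (forall x, x \in map toK u -> P (ofK x)).
Proof.
rewrite List.Forall_forall; split=> h x.
- move=> /mapP[y yu ->]; have -> : ofK (toK y) = y by apply: toK_inj; rewrite ofKK.
  apply: h; elim: u yu => [//|z u ih]; rewrite inE => /orP[/eqP->|/ih]; by [left|right].
- move=> xu; have -> : x = ofK (toK x) by apply: toK_inj; rewrite ofKK.
  apply: h; elim: u xu => [//|z u ih] /= [->|/ih]; rewrite inE ?eqxx //.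
  by move=> ->; rewrite orbT.
Qed.

Lemma lee_yang_polynomial_C (q : R) (u : list C) :
  Rle R0 q -> Rlt q R1 -> List.Forall in_disc u ->
  exists v, length v = S (length u) /\ List.Forall in_disc v /\
  forall w, Cplus (Cprod (fun x => Cminus (RtoC R1) (Cmult (Cmult x (RtoC q)) w)) u)
     (Cmult w (Cprod (fun x => Cminus (RtoC q) (Cmult x w)) u))
  = Cprod (fun x => Cminus (RtoC R1) (Cmult x w)) v.
Proof.
move=> /RleP q0 /RltP q1 /Forall_mem hu.
have [||x /hu/in_disc_toK|v [sv hv E]] :=
  @lee_yang_polynomial (complex R) (real_complex R q) (map toK u).
- by rewrite ler0c.
- by rewrite -[1]/(real_complex R 1) ltcR.
- by rewrite ofKK.
have vK : map toK (map ofK v) = v.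
  by rewrite -map_comp -[RHS]map_id; apply: eq_map => x /=; rewrite ofKK.
exists (map ofK v); split; [|split].
- by move: sv; rewrite size_map => <-; rewrite length_map.
- apply/Forall_mem; rewrite vK => x /hv; by rewrite in_disc_toK ofKK.
- move=> w; apply: toK_inj.
  rewrite toK_add toK_mul.
  rewrite (toK_Cprod (fun x => Cminus _ (Cmult (Cmult x _) w))
    (fun x => 1 - x * real_complex R q * toK w)) //.
  rewrite (toK_Cprod (fun x => Cminus (RtoC q) (Cmult x w))
    (fun x => real_complex R q - x * toK w)) //.
  by rewrite (toK_Cprod (fun x => Cminus (RtoC R1) (Cmult x w))
    (fun x => 1 - x * toK w)) // vK E.
Qed.

End LeeYangStep.

Lemma lee_yang_step (q : R) (u : list C) :
  (0 <= q < 1)%R -> List.Forall in_disc u ->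
  exists v, length v = S (length u) /\ List.Forall in_disc v /\
  forall w, Cprod (fun x => 1 - x * q * w) u + w * Cprod (fun x => q - x * w) u
    = Cprod (fun x => 1 - x * w) v.
Proof. intros [h0 h1]; exact (LeeYangStep.lee_yang_polynomial_C q u h0 h1). Qed.

(** * Spin sums *)

Lemma Ceq (z w : C) : Re z = Re w -> Im z = Im w -> z = w.
Proof. destruct z, w; simpl; intros -> ->; reflexivity. Qed.

Lemma Re_plus (z w : C) : Re (z + w) = (Re z + Re w)%R.
Proof. reflexivity. Qed.

Lemma Cexp_plus (z w : C) : Cexp (z + w) = Cexp z * Cexp w.
Proof.
destruct z as [a b], w as [c d]; unfold Cexp, Cplus, Cmult, Re, Im; simpl.
rewrite exp_plus, cos_plus, sin_plus; f_equal; ring.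
Qed.

Lemma Cexp_RtoC (x : R) : Cexp (RtoC x) = RtoC (exp x).
Proof.
unfold Cexp, RtoC, Re, Im; simpl; rewrite cos_0, sin_0; f_equal; ring.
Qed.

Lemma Cexp_0 : Cexp (RtoC 0) = RtoC 1.
Proof. rewrite Cexp_RtoC, exp_0; reflexivity. Qed.

Lemma Cmod_Cexp (z : C) : Cmod (Cexp z) = exp (Re z).
Proof.
unfold Cmod, Cexp; simpl.
pose proof (sin2_cos2 (Im z)) as e; unfold Rsqr in e.
replace (_ + _)%R with (exp (Re z) * exp (Re z))%R
  by (transitivity (exp (Re z) * exp (Re z) *
        (sin (Im z) * sin (Im z) + cos (Im z) * cos (Im z)))%R; [rewrite e|]; ring).
apply sqrt_square, Rlt_le, exp_pos.
Qed.

Lemma Cexp_neq_0 (z : C) : Cexp z <> 0.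
Proof.
apply Cmod_gt_0; rewrite Cmod_Cexp; apply exp_pos.
Qed.

Lemma Cexp_opp (z : C) : Cexp (- z) = / Cexp z.
Proof.
assert (e : Cexp (- z) * Cexp z = 1)
  by (rewrite <- Cexp_plus, <- Cexp_0; f_equal; ring).
rewrite <- (Cmult_1_l (/ Cexp z)), <- e; field; apply Cexp_neq_0.
Qed.

Lemma Cexp_eq (z w : C) : z = w -> Cexp z = Cexp w.
Proof. intros ->; reflexivity. Qed.

(** The weight of a configuration depends only on its total spin, so [phi] is a function of that
    sum, and prefixing a spin becomes a shift of its argument. *)
Definition spin_sum (n : nat) (phi : R -> C) : C :=
  Csum (map (fun sigma => phi (Rsum sigma)) (spin_configs n)).

Lemma Csum_app (s t : list C) : Csum (s ++ t) = Csum s + Csum t.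
Proof.
induction s as [|x s ih]; simpl; [ring|]. unfold Csum in *; rewrite ih; ring.
Qed.

Lemma spin_sum_0 (phi : R -> C) : spin_sum 0 phi = phi 0%R.
Proof. unfold spin_sum, Csum; simpl; ring. Qed.

Lemma spin_sum_S (n : nat) (phi : R -> C) :
  spin_sum (S n) phi =
  spin_sum n (fun s => phi (1 + s)%R) + spin_sum n (fun s => phi (-1 + s)%R).
Proof.
unfold spin_sum; simpl spin_configs.
rewrite map_app, Csum_app, !map_map; reflexivity.
Qed.

Lemma spin_sum_ext (n : nat) (phi psi : R -> C) :
  (forall s, phi s = psi s) -> spin_sum n phi = spin_sum n psi.
Proof.
intros e; unfold spin_sum; f_equal; apply map_ext; intros; apply e.
Qed.

Lemma spin_sum_plus (n : nat) (phi psi : R -> C) :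
  spin_sum n (fun s => phi s + psi s) = spin_sum n phi + spin_sum n psi.
Proof.
unfold spin_sum; induction (spin_configs n) as [|x l ih]; simpl; [ring|].
unfold Csum in *; rewrite ih; ring.
Qed.

Lemma spin_sum_scal (n : nat) (c : C) (phi : R -> C) :
  spin_sum n (fun s => c * phi s) = c * spin_sum n phi.
Proof.
unfold spin_sum; induction (spin_configs n) as [|x l ih]; simpl; [ring|].
unfold Csum in *; rewrite ih; ring.
Qed.

Lemma spin_sum_opp_arg (n : nat) (phi : R -> C) :
  spin_sum n (fun s => phi (- s)%R) = spin_sum n phi.
Proof.
revert phi; induction n as [|n ih]; intros phi.
- rewrite !spin_sum_0; f_equal; ring.
- rewrite !spin_sum_S, Cplus_comm; f_equal; rewrite <- ih;
    apply spin_sum_ext; intros s; f_equal; ring.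
Qed.

(* By exchangeability the total spin may be replaced by [S n] times the first spin. *)
Lemma spin_sum_exchange (n : nat) (phi : R -> C) :
  spin_sum (S n) (fun s => RtoC s * phi s) =
  RtoC (INR (S n)) *
  (spin_sum n (fun s => phi (1 + s)%R) - spin_sum n (fun s => phi (-1 + s)%R)).
Proof.
(* Here s is the sum of n spins other than a distinguished one, over whose two values [phi] is
   summed; each of the n contributes as much as the distinguished one. In the induction [psi], the
   sum over the distinguished spin, takes the place of [phi]. *)
assert (aux : forall n phi,
  spin_sum n (fun s => RtoC s * (phi (1 + s)%R + phi (-1 + s)%R)) =
  RtoC (INR n) *
  (spin_sum n (fun s => phi (1 + s)%R) - spin_sum n (fun s => phi (-1 + s)%R)));
  [clear n phi; intros n|].
- induction n as [|n ih]; intros phi.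
  + rewrite spin_sum_0; simpl; ring.
  + set (psi := fun s => phi (1 + s)%R + phi (-1 + s)%R).
    assert (e : spin_sum (S n) (fun s => RtoC s * psi s) =
      spin_sum n (fun s => RtoC s * (psi (1 + s)%R + psi (-1 + s)%R))
      + (spin_sum n (fun s => psi (1 + s)%R) - spin_sum n (fun s => psi (-1 + s)%R))).
    { rewrite spin_sum_S.
      transitivity (spin_sum n (fun s => RtoC s * psi (1 + s)%R + psi (1 + s)%R)
        + spin_sum n (fun s => RtoC s * psi (-1 + s)%R + (-1) * psi (-1 + s)%R)).
      - f_equal; apply spin_sum_ext; intros s; rewrite RtoC_plus; ring.
      - rewrite !spin_sum_plus, spin_sum_scal.
        rewrite (spin_sum_ext n (fun s => RtoC s * (_ + _))
          (fun s => RtoC s * psi (1 + s)%R + RtoC s * psi (-1 + s)%R))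
          by (intros; ring).
        rewrite spin_sum_plus; ring. }
    change (spin_sum (S n) (fun s => RtoC s * psi s) = RtoC (INR (S n)) *
      (spin_sum (S n) (fun s => phi (1 + s)%R)
       - spin_sum (S n) (fun s => phi (-1 + s)%R))).
    rewrite e, ih, !spin_sum_S, S_INR, RtoC_plus.
    unfold psi; rewrite !spin_sum_plus.
    rewrite (spin_sum_ext n (fun s => phi (1 + (-1 + s))%R)
      (fun s => phi (-1 + (1 + s))%R)) by (intros; f_equal; ring).
    ring.
- rewrite spin_sum_S.
  transitivity (spin_sum n (fun s => RtoC s * (phi (1 + s)%R + phi (-1 + s)%R))
    + (spin_sum n (fun s => phi (1 + s)%R) - spin_sum n (fun s => phi (-1 + s)%R))).
  + rewrite (spin_sum_ext n (fun s => RtoC s * (phi (1 + s)%R + phi (-1 + s)%R))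
      (fun s => RtoC s * phi (1 + s)%R + RtoC s * phi (-1 + s)%R)) by (intros; ring).
    rewrite (spin_sum_ext n (fun s => RtoC (1 + s) * phi (1 + s)%R)
      (fun s => RtoC s * phi (1 + s)%R + phi (1 + s)%R))
      by (intros; rewrite RtoC_plus; ring).
    rewrite (spin_sum_ext n (fun s => RtoC (-1 + s) * phi (-1 + s)%R)
      (fun s => RtoC s * phi (-1 + s)%R + (-1) * phi (-1 + s)%R))
      by (intros; rewrite RtoC_plus; ring).
    rewrite !spin_sum_plus, spin_sum_scal; ring.
  + rewrite aux, S_INR, RtoC_plus; ring.
Qed.

Definition weight (J : R) (h : C) (s : R) : C := Cexp (RtoC (J / 2 * s ^ 2)%R + h * RtoC s).

(** The coupling is a parameter separate from n because systems of n and n - 1 spins are compared at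
    the same J. *)
Definition spin_pf (n : nat) (J : R) (h : C) : C := spin_sum n (weight J h).

Lemma Zcw_spin_pf (n : nat) (beta : R) (h : C) :
  Zcw n beta h = spin_pf n (beta / INR n) h.
Proof.
unfold Zcw, spin_pf, spin_sum, weight; f_equal; apply map_ext; intros sigma.
do 4 f_equal; unfold Rdiv; rewrite Rinv_mult; ring.
Qed.

Lemma Zcw_even (n : nat) (beta : R) (h : C) : Zcw n beta (- h) = Zcw n beta h.
Proof.
rewrite !Zcw_spin_pf; unfold spin_pf; rewrite <- spin_sum_opp_arg.
apply spin_sum_ext; intros s; apply Cexp_eq; rewrite RtoC_opp.
replace ((- s) ^ 2)%R with (s ^ 2)%R by ring; ring.
Qed.

(** The cross term J s of J (1 + s)^2 / 2 acts as a shift of the field by J. *)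
Lemma weight_up (J : R) (h : C) (s : R) :
  weight J h (1 + s)%R = Cexp (RtoC (J / 2)) * Cexp h * weight J (h + RtoC J) s.
Proof.
unfold weight; rewrite <- !Cexp_plus; apply Cexp_eq.
replace (J / 2 * (1 + s) ^ 2)%R with (J / 2 * s ^ 2 + J / 2 + J * s)%R by field.
rewrite !RtoC_plus, (RtoC_mult J s); ring.
Qed.

Lemma weight_down (J : R) (h : C) (s : R) :
  weight J h (-1 + s)%R = Cexp (RtoC (J / 2)) * Cexp (- h) * weight J (h - RtoC J) s.
Proof.
unfold weight; rewrite <- !Cexp_plus; apply Cexp_eq.
replace (J / 2 * (-1 + s) ^ 2)%R with (J / 2 * s ^ 2 + J / 2 - J * s)%R by field.
rewrite RtoC_minus, !RtoC_plus, (RtoC_mult J s); ring.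
Qed.

(* The contributions of the configurations whose first spin is [1], resp. [-1]. *)
Definition pf_up (n : nat) (J : R) (h : C) : C :=
  Cexp (RtoC (J / 2)) * Cexp h * spin_pf n J (h + RtoC J).
Definition pf_down (n : nat) (J : R) (h : C) : C :=
  Cexp (RtoC (J / 2)) * Cexp (- h) * spin_pf n J (h - RtoC J).

Lemma spin_sum_up (n : nat) (J : R) (h : C) :
  spin_sum n (fun s => weight J h (1 + s)%R) = pf_up n J h.
Proof.
unfold pf_up, spin_pf; rewrite <- spin_sum_scal.
apply spin_sum_ext; intros s; apply weight_up.
Qed.

Lemma spin_sum_down (n : nat) (J : R) (h : C) :
  spin_sum n (fun s => weight J h (-1 + s)%R) = pf_down n J h.
Proof.
unfold pf_down, spin_pf; rewrite <- spin_sum_scal.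
apply spin_sum_ext; intros s; apply weight_down.
Qed.

Lemma spin_pf_S (n : nat) (J : R) (h : C) :
  spin_pf (S n) J h = pf_up n J h + pf_down n J h.
Proof.
unfold spin_pf at 1; rewrite spin_sum_S, spin_sum_up, spin_sum_down; reflexivity.
Qed.

(** The left side is the h-derivative of [spin_pf (S n) J]; together with [spin_pf_S] it expresses
    both contributions through the partition function and its derivative. *)
Lemma spin_pf_first_moment (n : nat) (J : R) (h : C) :
  spin_sum (S n) (fun s => RtoC s * weight J h s) =
  RtoC (INR (S n)) * (pf_up n J h - pf_down n J h).
Proof. rewrite spin_sum_exchange, spin_sum_up, spin_sum_down; reflexivity. Qed.

Lemma Cprod_ext (f g : C -> C) (u : list C) :
  (forall x, f x = g x) -> Cprod f u = Cprod g u.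
Proof.
intros e; induction u as [|x u ih]; simpl; [reflexivity|rewrite e, ih; reflexivity].
Qed.

Lemma Cprod_Cexp_scal (a : C) (f : C -> C) (u : list C) :
  Cprod (fun x => Cexp a * f x) u = Cexp (RtoC (INR (length u)) * a) * Cprod f u.
Proof.
induction u as [|x u ih].
- simpl; rewrite Cmult_0_l, Cexp_0; ring.
- change (length (x :: u)) with (S (length u)); rewrite S_INR, RtoC_plus; simpl.
  rewrite ih, Cmult_plus_distr_r, Cexp_plus, Cmult_1_l; ring.
Qed.

Definition fugacity (h : C) : C := Cexp (- (2 * h)).

(** The prefactor is the weight of the all-up configuration; dividing by it leaves a polynomial in
    the fugacity with constant term 1. Shifting h by J or - J multiplies the fugacity by q or 1/q, q
    = e^(-2J), which is the situation of [lee_yang_step]. *)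
Lemma lee_yang (n : nat) (J : R) : (0 < J)%R ->
  exists u, length u = n /\ List.Forall in_disc u /\
  forall h, spin_pf n J h =
    Cexp (RtoC (J / 2 * INR n ^ 2)%R + RtoC (INR n) * h)
    * Cprod (fun x => 1 - x * fugacity h) u.
Proof.
intros hJ; induction n as [|n [u [hl [hu e]]]].
- exists nil; repeat split; [constructor|]; intros h; unfold spin_pf.
  rewrite spin_sum_0; unfold weight; simpl; rewrite Cmult_1_r; apply Cexp_eq.
  ring.
- destruct (lee_yang_step (exp (- (2 * J))) u) as [v [hv [hd ev]]]; [|exact hu|].
  { split; [apply Rlt_le, exp_pos|]. rewrite <- exp_0; apply exp_increasing; lra. }
  exists v; split; [congruence|split; [exact hd|]]; intros h.
  assert (q : RtoC (exp (- (2 * J))) = Cexp (- (2 * RtoC J)))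
    by (rewrite <- Cexp_RtoC, RtoC_opp, RtoC_mult; reflexivity).
  rewrite <- ev, spin_pf_S; unfold pf_up, pf_down; rewrite !e, q.
  rewrite (Cprod_ext (fun x => 1 - x * fugacity (h + J))
    (fun x => 1 - x * Cexp (- (2 * J)) * fugacity h)).
  2:{ intros x; unfold fugacity.
      replace (- (2 * (h + J))) with (- (2 * J) + - (2 * h)) by ring.
      rewrite Cexp_plus; ring. }
  rewrite (Cprod_ext (fun x => Cexp (- (2 * J)) - x * fugacity h)
    (fun x => Cexp (- (2 * J)) * (1 - x * fugacity (h - J)))).
  2:{ intros x; unfold fugacity.
      replace (- (2 * h)) with (- (2 * J) + - (2 * (h - J))) by ring.
      rewrite Cexp_plus; ring. }
  rewrite Cprod_Cexp_scal, hl, (Cmult_plus_distr_l _ (Cprod _ u)); unfold fugacity.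
  replace (RtoC (J / 2 * INR (S n) ^ 2)%R)
    with (RtoC (J / 2 * INR n ^ 2)%R + RtoC (J / 2)%R + RtoC J * RtoC (INR n))
    by (rewrite S_INR, <- RtoC_mult, <- !RtoC_plus; f_equal; field).
  rewrite S_INR, RtoC_plus, !Cmult_assoc, <- !Cexp_plus.
  apply (f_equal2 Cplus); apply (f_equal2 Cmult); try reflexivity;
    apply Cexp_eq; ring.
Qed.

(** * Complex differentiation *)

Lemma Cmod_le_Re_Im (z : C) : (Cmod z <= Rabs (Re z) + Rabs (Im z))%R.
Proof.
replace z with (RtoC (Re z) + Ci * RtoC (Im z)) at 1 by (apply Ceq; simpl; ring).
eapply Rle_trans; [apply Cmod_triangle|].
rewrite Cmod_mult, Cmod_Ci, !Cmod_R; lra.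
Qed.

Lemma Im_le_Cmod (z : C) : (Rabs (Im z) <= Cmod z)%R.
Proof.
replace (Im z) with (Re (- Ci * z)) by (destruct z; simpl; ring).
eapply Rle_trans; [apply re_le_Cmod|].
rewrite Cmod_mult, Cmod_opp, Cmod_Ci; lra.
Qed.

Lemma Cmod_minus_le (z w : C) : (Cmod (z - w) <= Cmod z + Cmod w)%R.
Proof.
eapply Rle_trans; [apply Cmod_triangle|rewrite Cmod_opp; lra].
Qed.

Lemma Cmod_minus_ge (z w : C) : (Cmod z - Cmod w <= Cmod (z - w))%R.
Proof.
pose proof (Cmod_triangle (z - w) w) as h.
replace (z - w + w) with z in h by ring; lra.
Qed.

Lemma Cmod_minus_sym (z w : C) : Cmod (z - w) = Cmod (w - z).
Proof. rewrite <- Cmod_opp; f_equal; ring. Qed.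

Lemma is_derive_eps {K : AbsRing} {V : NormedModule K} (f : K -> V) (x : K) (l : V) :
  is_derive f x l <-> (forall eps : posreal, locally x (fun y =>
    norm (minus (minus (f y) (f x)) (scal (minus y x) l)) <= eps * norm (minus y x))).
Proof.
split.
- intros [_ h]; exact (h x (fun P H => H)).
- intros h; split; [apply is_linear_scal_l|].
  intros y hy.
  rewrite <- (is_filter_lim_locally_unique _ _ hy); exact h.
Qed.

Definition is_cderive (f : C -> C) (z l : C) : Prop :=
  @is_derive C_AbsRing C_NormedModule f z l.

Lemma is_cderive_eps (f : C -> C) (z l : C) :
  is_cderive f z l <-> (forall eps, (0 < eps)%R -> exists delta, (0 < delta)%R /\
    forall s, (Cmod s < delta)%R ->
      (Cmod (f (z + s)%C - f z - s * l) <= eps * Cmod s)%R).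
Proof.
unfold is_cderive; rewrite is_derive_eps; split.
- intros h eps heps; destruct (h (mkposreal eps heps)) as [d hd].
  exists d; split; [apply cond_pos|]; intros s hs.
  specialize (hd (z + s)).
  assert (e : z + s - z = s) by ring.
  assert (b : @ball (AbsRing_UniformSpace C_AbsRing) z d (z + s)).
  { change (Cmod (z + s - z) < d)%R; rewrite e; exact hs. }
  specialize (hd b).
  change (Cmod (f (z + s)%C - f z - (z + s - z) * l) <= eps * Cmod (z + s - z))%R in hd.
  rewrite e in hd; exact hd.
- intros h eps; destruct (h eps (cond_pos eps)) as [d [hd hs]].
  exists (mkposreal d hd); intros y hy.
  assert (e : forall y : C, z + (y - z) = y) by (intros; ring).
  specialize (hs (y - z) hy); rewrite e in hs.
  exact hs.
Qed.

(** The rules for products and the identity are stated for [AbsRing_NormedModule C_AbsRing], the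
    statement to be proved for [C_NormedModule]; in epsilon form the two notions coincide. *)
Lemma is_cderive_AbsRing (f : C -> C) (z l : C) :
  is_cderive f z l <-> @is_derive C_AbsRing (AbsRing_NormedModule C_AbsRing) f z l.
Proof. unfold is_cderive; rewrite !is_derive_eps; reflexivity. Qed.

Lemma is_cderive_ext (f g : C -> C) (z l : C) :
  (forall y, f y = g y) -> is_cderive f z l -> is_cderive g z l.
Proof. intros e; apply is_derive_ext, e. Qed.

Lemma is_cderive_eq (f : C -> C) (z l l' : C) :
  is_cderive f z l -> l = l' -> is_cderive f z l'.
Proof. intros h <-; exact h. Qed.

Lemma is_cderive_const (c z : C) : is_cderive (fun _ => c) z 0.
Proof. exact (@is_derive_const C_AbsRing C_NormedModule c z). Qed.

Lemma is_cderive_id (z : C) : is_cderive (fun y => y) z 1.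
Proof. apply is_cderive_AbsRing; exact (@is_derive_id C_AbsRing z). Qed.

Lemma is_cderive_plus (f g : C -> C) (z df dg : C) :
  is_cderive f z df -> is_cderive g z dg ->
  is_cderive (fun y => f y + g y) z (df + dg).
Proof. exact (@is_derive_plus C_AbsRing C_NormedModule f g z df dg). Qed.

Lemma is_cderive_minus (f g : C -> C) (z df dg : C) :
  is_cderive f z df -> is_cderive g z dg ->
  is_cderive (fun y => f y - g y) z (df - dg).
Proof. exact (@is_derive_minus C_AbsRing C_NormedModule f g z df dg). Qed.

Lemma is_cderive_comp (f g : C -> C) (z df dg : C) :
  is_cderive f (g z) df -> is_cderive g z dg ->
  is_cderive (fun y => f (g y)) z (dg * df).
Proof.
intros hf hg; apply is_cderive_eps; intros eps heps.
rewrite is_cderive_eps in hf; rewrite is_cderive_eps in hg.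
set (M := (Cmod df + Cmod dg + 2)%R).
assert (hM : (2 <= M)%R) by (unfold M; pose proof (Cmod_ge_0 df);
  pose proof (Cmod_ge_0 dg); lra).
(* With t the increment of [g], e <= 1 gives |t| <= M |s|; the remainder is at most e |t| + e |s|
   |df| <= 2 M e |s|. *)
set (e := Rmin 1 (eps / (2 * M))).
assert (he : (0 < e <= 1)%R).
{ split; [apply Rmin_pos; [lra|apply Rdiv_lt_0_compat; lra]|apply Rmin_l]. }
assert (hee : (e * (2 * M) <= eps)%R).
{ apply Rle_trans with (eps / (2 * M) * (2 * M))%R; [|right; field; lra].
  apply Rmult_le_compat_r; [lra|apply Rmin_r]. }
destruct (hf e (proj1 he)) as [d1 [hd1 h1]].
destruct (hg e (proj1 he)) as [d2 [hd2 h2]].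
exists (Rmin d2 (d1 / M)); split.
{ apply Rmin_pos; [lra|apply Rdiv_lt_0_compat; lra]. }
intros s hs.
assert (hs2 : (Cmod s < d2)%R) by (eapply Rlt_le_trans; [exact hs|apply Rmin_l]).
assert (hs1 : (Cmod s * M < d1)%R).
{ apply Rlt_le_trans with (d1 / M * M)%R; [|right; field; lra].
  apply Rmult_lt_compat_r; [lra|]; eapply Rlt_le_trans; [exact hs|apply Rmin_r]. }
specialize (h2 s hs2); set (t := g (z + s) - g z).
assert (ht : (Cmod t <= M * Cmod s)%R).
{ replace t with (g (z + s) - g z - s * dg + s * dg) by (unfold t; ring).
  eapply Rle_trans; [apply Cmod_triangle|]; rewrite Cmod_mult.
  pose proof (Cmod_ge_0 s); pose proof (Cmod_ge_0 df); unfold M; nra. }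
specialize (h1 t); replace (g z + t) with (g (z + s)) in h1 by (unfold t; ring).
assert (h1' : (Cmod t < d1)%R) by lra; specialize (h1 h1').
replace (f (g (z + s)) - f (g z) - s * (dg * df)) with
  ((f (g (z + s)) - f (g z) - t * df) + (g (z + s) - g z - s * dg) * df)
  by (unfold t; ring).
eapply Rle_trans; [apply Cmod_triangle|]; rewrite Cmod_mult.
pose proof (Cmod_ge_0 s) as hs0; pose proof (Cmod_ge_0 df); pose proof (Cmod_ge_0 dg).
apply Rle_trans with (e * (2 * M) * Cmod s)%R; [|nra].
assert (A1 : (e * Cmod t <= e * (M * Cmod s))%R) by (apply Rmult_le_compat_l; lra).
assert (A2 : (Cmod (g (z + s)%C - g z - s * dg) * Cmod df <= e * Cmod s * M)%R).
{ apply Rmult_le_compat; try apply Cmod_ge_0; [exact h2|unfold M; lra]. }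
lra.
Qed.

Lemma is_cderive_mult (f g : C -> C) (z df dg : C) :
  is_cderive f z df -> is_cderive g z dg ->
  is_cderive (fun y => f y * g y) z (df * g z + f z * dg).
Proof.
rewrite !is_cderive_AbsRing; intros hf hg.
exact (@is_derive_mult C_AbsRing f g z df dg hf hg Cmult_comm).
Qed.

Lemma is_cderive_Cinv (z : C) : z <> 0 -> is_cderive Cinv z (- / (z * z)).
Proof.
intros hz; apply is_cderive_eps; intros eps heps.
assert (hm : (0 < Cmod z)%R) by (apply Cmod_gt_0; exact hz).
set (m := Cmod z) in *.
(* The first bound keeps |z + s| >= m/2; the second absorbs the remainder s^2 / (z^2 (z + s)), whose
   denominator then has modulus at least m^3 / 2. *)
exists (Rmin (m / 2) (eps * m ^ 3 / 2)); split.
{ apply Rmin_pos; [lra|]; pose proof (pow_lt m 3 hm); nra. }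
intros s hs.
assert (h1 : (Cmod s < m / 2)%R) by (eapply Rlt_le_trans; [exact hs|apply Rmin_l]).
assert (h2 : (Cmod s < eps * m ^ 3 / 2)%R)
  by (eapply Rlt_le_trans; [exact hs|apply Rmin_r]).
assert (hzs : (m / 2 <= Cmod (z + s))%R).
{ replace (z + s) with (z - (- s)) by ring.
  eapply Rle_trans; [|apply Cmod_minus_ge]; rewrite Cmod_opp; fold m; lra. }
assert (nz : z + s <> 0) by (apply Cmod_gt_0; lra).
replace (/ (z + s) - / z - s * - / (z * z)) with (s * (s * / (z * z * (z + s))))
  by (field; auto).
rewrite Cmod_mult, Rmult_comm; apply Rmult_le_compat_r; [apply Cmod_ge_0|].
rewrite Cmod_mult, Cmod_inv, !Cmod_mult by (repeat apply Cmult_neq_0; assumption).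
fold m; apply Rmult_le_reg_r with (m * m * Cmod (z + s))%R.
{ repeat apply Rmult_lt_0_compat; lra. }
rewrite Rmult_assoc, Rinv_l, Rmult_1_r
  by (apply Rgt_not_eq; repeat apply Rmult_lt_0_compat; lra).
apply Rle_trans with (eps * (m * m * (m / 2)))%R; [lra|].
apply Rmult_le_compat_l; [lra|]; apply Rmult_le_compat_l; [nra|exact hzs].
Qed.

Lemma is_cderive_path (f : C -> C) (a v l : C) (t : R) :
  is_cderive f (a + RtoC t * v) l ->
  is_derive (fun t : R => Re (f (a + RtoC t * v))) t (Re (v * l)).
Proof.
intros h; apply is_derive_eps; intros eps.
rewrite is_cderive_eps in h.
assert (hv : (0 < Cmod v + 1)%R) by (pose proof (Cmod_ge_0 v); lra).
destruct (h (eps / (Cmod v + 1))%R) as [d [hd hs]].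
{ apply Rdiv_lt_0_compat; [apply cond_pos|lra]. }
assert (hd' : (0 < d / (Cmod v + 1))%R) by (apply Rdiv_lt_0_compat; lra).
exists (mkposreal _ hd'); intros y hy.
change (Rabs (y - t) < d / (Cmod v + 1))%R in hy.
change (Rabs ((Re (f (a + y * v)%C) - Re (f (a + t * v)%C)) - (y - t) * Re (v * l))
  <= eps * Rabs (y - t))%R.
specialize (hs (RtoC (y - t) * v)).
replace (a + t * v + (y - t)%R * v) with (a + y * v) in hs
  by (rewrite RtoC_minus; ring).
assert (hb : (Cmod ((y - t)%R * v) <= Rabs (y - t) * (Cmod v + 1))%R).
{ rewrite Cmod_mult, Cmod_R; pose proof (Rabs_pos (y - t)); nra. }
assert (hc : (Cmod ((y - t)%R * v) < d)%R).
{ eapply Rle_lt_trans; [exact hb|].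
  apply Rlt_le_trans with (d / (Cmod v + 1) * (Cmod v + 1))%R; [|right; field; lra].
  apply Rmult_lt_compat_r; assumption. }
specialize (hs hc).
replace (Re (f (a + y * v)%C) - Re (f (a + t * v)%C) - (y - t) * Re (v * l))%R
  with (Re (f (a + y * v) - f (a + t * v) - (y - t)%R * v * l))
  by (unfold Re; simpl; ring).
eapply Rle_trans; [apply re_le_Cmod|]; eapply Rle_trans; [exact hs|].
apply Rle_trans with (eps / (Cmod v + 1) * (Rabs (y - t) * (Cmod v + 1)))%R;
  [|right; field; lra].
apply Rmult_le_compat_l; [apply Rlt_le, Rdiv_lt_0_compat; [apply cond_pos|lra]|exact hb].
Qed.

Lemma is_cderive_unique (f : C -> C) (z l l' : C) :
  is_cderive f z l -> is_cderive f z l' -> l = l'.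
Proof.
intros h h'; rewrite <- (is_C_derive_unique f z l h); apply is_C_derive_unique, h'.
Qed.

(* The real mean value theorem is applied to the projection on the direction of
   the increment. *)
Lemma cderive_increment_le (f df : C -> C) (a v : C) (M : R) :
  (forall t : R, (0 <= t <= 1)%R ->
    is_cderive f (a + RtoC t * v) (df (a + RtoC t * v)) /\
    (Cmod (df (a + RtoC t * v)%C) <= M)%R) ->
  (Cmod (f (a + v)%C - f a) <= M * Cmod v)%R.
Proof.
intros h; set (D := f (a + v) - f a).
set (g := fun z => Cconj D * f z).
set (phi := fun t : R => Re (g (a + RtoC t * v))).
assert (hd : forall t, (0 <= t <= 1)%R ->
  is_derive phi t (Re (v * (Cconj D * df (a + RtoC t * v))))).
{ intros t ht; apply is_cderive_path; unfold g.
  eapply is_cderive_eq.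
  - apply is_cderive_mult; [apply is_cderive_const|apply (h t ht)].
  - rewrite Cmult_0_l, Cplus_0_l; reflexivity. }
destruct (MVT_gen phi 0 1 (fun t => Re (v * (Cconj D * df (a + RtoC t * v)))))
  as [c [hc e]].
{ intros x; rewrite Rmin_left, Rmax_right by lra; intros; apply hd; lra. }
{ intros x; rewrite Rmin_left, Rmax_right by lra; intros hx.
  apply continuity_pt_filterlim.
  apply (ex_derive_continuous phi); eexists; apply hd; exact hx. }
rewrite Rmin_left, Rmax_right in hc by lra.
assert (e1 : (phi 1 - phi 0 = Cmod D * Cmod D)%R).
{ unfold phi, g.
  replace (a + 1 * v) with (a + v) by ring; replace (a + 0 * v) with a by ring.
  transitivity (Re (Cconj D * D)); [unfold D, Re; simpl; ring|].
  rewrite Cmult_comm, <- Cmod2_conj; simpl; ring. }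
rewrite e1 in e.
assert (hle : (Cmod D * Cmod D <= Cmod D * (M * Cmod v))%R).
{ rewrite e; eapply Rle_trans; [apply Rle_abs|].
  rewrite Rminus_0_r, Rmult_1_r; eapply Rle_trans; [apply re_le_Cmod|].
  rewrite !Cmod_mult, Cmod_conj; destruct (h c hc) as [_ hm].
  pose proof (Cmod_ge_0 v); pose proof (Cmod_ge_0 D).
  apply Rle_trans with (Cmod v * (Cmod D * M))%R; [|right; ring].
  repeat (apply Rmult_le_compat_l; [assumption|]); exact hm. }
destruct (Cmod_ge_0 D) as [hp|hz].
- apply Rmult_le_reg_l with (Cmod D); assumption.
(* For D = 0 the claim still needs M >= 0, which the bound at t = 0 provides. *)
- rewrite <- hz; destruct (h 0%R) as [_ hm]; [lra|].
  pose proof (Cmod_ge_0 v); pose proof (Cmod_ge_0 (df (a + RtoC 0 * v)%C)).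
  apply Rmult_le_pos; lra.
Qed.

Lemma ex_derive_cderive (f : C -> C) (z : C) :
  @ex_derive C_AbsRing C_NormedModule f z <-> exists l, is_cderive f z l.
Proof. reflexivity. Qed.

Global Opaque is_cderive.

(** * Exponential and logarithm *)

Lemma is_derive_R_eps (f : R -> R) (l : R) : is_derive f 0 l ->
  forall eps, (0 < eps)%R -> exists delta, (0 < delta)%R /\
  forall y, (Rabs y < delta)%R -> (Rabs (f y - f 0%R - l * y) <= eps * Rabs y)%R.
Proof.
intros h eps heps; rewrite is_derive_eps in h.
destruct (h (mkposreal eps heps)) as [d hd].
exists d; split; [apply cond_pos|]; intros y hy.
assert (b : Rabs (y - 0) < d) by (rewrite Rminus_0_r; exact hy).
specialize (hd y b).
change (Rabs (f y - f 0%R - (y - 0) * l) <= eps * Rabs (y - 0))%R in hd.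
rewrite Rminus_0_r in hd; rewrite (Rmult_comm l y); exact hd.
Qed.

(** By the functional equation the remainder is e^z (e^s - 1 - s), so only the real derivatives of
    exp, cos and sin at 0 enter. *)
Lemma is_cderive_Cexp (z : C) : is_cderive Cexp z (Cexp z).
Proof.
apply is_cderive_eps; intros eps heps.
assert (hE : (0 < exp (Re z))%R) by apply exp_pos.
(* Real and imaginary parts of e^s - 1 - s add up to at most 6 e |s|; the 8 leaves room. *)
set (e := Rmin 1 (eps / (8 * exp (Re z)))).
assert (he : (0 < e <= 1)%R).
{ split; [apply Rmin_pos; [lra|apply Rdiv_lt_0_compat; lra]|apply Rmin_l]. }
assert (hee : (exp (Re z) * (8 * e) <= eps)%R).
{ apply Rle_trans with (exp (Re z) * (8 * (eps / (8 * exp (Re z)))))%R; [|right; field; lra].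
  apply Rmult_le_compat_l; [lra|]; apply Rmult_le_compat_l; [lra|apply Rmin_r]. }
assert (dE : is_derive exp 0 1) by (auto_derive; [trivial|rewrite exp_0; ring]).
assert (dC : is_derive cos 0 0) by (auto_derive; [trivial|rewrite sin_0; ring]).
assert (dS : is_derive sin 0 1) by (auto_derive; [trivial|rewrite cos_0; ring]).
destruct (is_derive_R_eps _ _ dE e (proj1 he)) as [d1 [h1 H1]].
destruct (is_derive_R_eps _ _ dC e (proj1 he)) as [d2 [h2 H2]].
destruct (is_derive_R_eps _ _ dS e (proj1 he)) as [d3 [h3 H3]].
exists (Rmin (Rmin d1 d2) (Rmin d3 (e / 2))); split.
{ repeat apply Rmin_pos; lra. }
intros s hs.
pose proof (re_le_Cmod s) as ra; pose proof (Im_le_Cmod s) as rb.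
assert (hs1 : (Cmod s < d1)%R) by (eapply Rlt_le_trans; [exact hs|];
  eapply Rle_trans; [apply Rmin_l|apply Rmin_l]).
assert (hs2 : (Cmod s < d2)%R) by (eapply Rlt_le_trans; [exact hs|];
  eapply Rle_trans; [apply Rmin_l|apply Rmin_r]).
assert (hs3 : (Cmod s < d3)%R) by (eapply Rlt_le_trans; [exact hs|];
  eapply Rle_trans; [apply Rmin_r|apply Rmin_l]).
assert (hs4 : (Cmod s < e / 2)%R) by (eapply Rlt_le_trans; [exact hs|];
  eapply Rle_trans; [apply Rmin_r|apply Rmin_r]).
rewrite Cexp_plus.
replace (Cexp z * Cexp s - Cexp z - s * Cexp z) with (Cexp z * (Cexp s - 1 - s)) by ring.
rewrite Cmod_mult, Cmod_Cexp.
apply Rle_trans with (exp (Re z) * (8 * e * Cmod s))%R.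
2:{ pose proof (Cmod_ge_0 s); nra. }
apply Rmult_le_compat_l; [lra|].
eapply Rle_trans; [apply Cmod_le_Re_Im|].
specialize (H1 (Re s) (Rle_lt_trans _ _ _ ra hs1)).
specialize (H2 (Im s) (Rle_lt_trans _ _ _ rb hs2)).
specialize (H3 (Im s) (Rle_lt_trans _ _ _ rb hs3)).
rewrite exp_0 in H1; rewrite cos_0 in H2; rewrite sin_0 in H3.
replace (Re (Cexp s - 1 - s)) with
  ((exp (Re s) - 1 - 1 * Re s) + exp (Re s) * (cos (Im s) - 1 - 0 * Im s))%R
  by (unfold Cexp, Re, Im; simpl; ring).
replace (Im (Cexp s - 1 - s)) with
  (exp (Re s) * (sin (Im s) - 0 - 1 * Im s) + (exp (Re s) - 1) * Im s)%R
  by (unfold Cexp, Re, Im; simpl; ring).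
assert (X : (Rabs (exp (Re s) - 1) <= e)%R).
{ replace (exp (Re s) - 1)%R with ((exp (Re s) - 1 - 1 * Re s) + Re s)%R by ring.
  eapply Rle_trans; [apply Rabs_triang|]; pose proof (Rabs_pos (Re s)); nra. }
assert (Y : (Rabs (exp (Re s)) <= 2)%R).
{ replace (exp (Re s)) with ((exp (Re s) - 1) + 1)%R by ring.
  eapply Rle_trans; [apply Rabs_triang|]; rewrite Rabs_R1; lra. }
eapply Rle_trans; [apply Rplus_le_compat; apply Rabs_triang|].
rewrite !Rabs_mult.
pose proof (Rabs_pos (Re s)); pose proof (Rabs_pos (Im s)).
pose proof (Rabs_pos (exp (Re s))); pose proof (Rabs_pos (exp (Re s) - 1)).
assert (Z1 : (Rabs (exp (Re s)) * Rabs (cos (Im s) - 1 - 0 * Im s) <= 2 * (e * Rabs (Im s)))%R)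
  by (apply Rmult_le_compat; try apply Rabs_pos; assumption).
assert (Z2 : (Rabs (exp (Re s)) * Rabs (sin (Im s) - 0 - 1 * Im s) <= 2 * (e * Rabs (Im s)))%R)
  by (apply Rmult_le_compat; try apply Rabs_pos; assumption).
assert (Z3 : (Rabs (exp (Re s) - 1) * Rabs (Im s) <= e * Rabs (Im s))%R)
  by (apply Rmult_le_compat_r; assumption).
assert (Z4 : (e * Rabs (Re s) <= e * Cmod s)%R) by (apply Rmult_le_compat_l; lra).
assert (Z5 : (e * Rabs (Im s) <= e * Cmod s)%R) by (apply Rmult_le_compat_l; lra).
pose proof (Cmod_ge_0 s); nra.
Qed.

Lemma Cmod_Cexp_minus_1_le (z : C) : (Cmod (Cexp z - 1) <= exp (Cmod z) * Cmod z)%R.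
Proof.
pose proof (cderive_increment_le Cexp Cexp 0 z (exp (Cmod z))) as h.
rewrite Cexp_0 in h; replace (0 + z) with z in h by ring.
apply h; intros t ht; split; [apply is_cderive_Cexp|].
rewrite Cmod_Cexp.
assert (le : (Re (0 + t * z) <= Cmod z)%R).
{ eapply Rle_trans; [apply Rle_abs|]; eapply Rle_trans; [apply re_le_Cmod|].
  replace (0 + t * z) with (t * z) by ring.
  rewrite Cmod_mult, Cmod_R, Rabs_pos_eq by lra; pose proof (Cmod_ge_0 z); nra. }
destruct le as [lt| ->]; [left; apply exp_increasing, lt|right; reflexivity].
Qed.

Lemma Cmod_pos_of_Re (z : C) : (0 < Re z)%R -> (0 < Cmod z)%R.
Proof.
intros h; eapply Rlt_le_trans; [exact h|].
eapply Rle_trans; [apply Rle_abs|apply re_le_Cmod].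
Qed.

(** On the right half-plane the case distinction in [Carg] disappears into one smooth formula; every
    logarithm below is taken there. *)
Lemma Carg_Re_pos (z : C) : (0 < Re z)%R -> Carg z = atan (Im z / Re z).
Proof.
intros h; pose proof (Cmod_pos_of_Re z h) as hm.
assert (hx : (0 < Re z / Cmod z)%R) by (apply Rdiv_lt_0_compat; assumption).
assert (e : acos (Re z / Cmod z) = atan (Rabs (Im z) / Re z)).
{ rewrite acos_atan by exact hx; f_equal.
  replace (1 - (Re z / Cmod z)²)%R with ((Im z / Cmod z)²)%R.
  - rewrite sqrt_Rsqr_abs; unfold Rdiv; rewrite Rabs_mult.
    rewrite (Rabs_pos_eq (/ Cmod z)) by (left; apply Rinv_0_lt_compat, hm).
    field; lra.
  - pose proof (Cmod2_alt z) as e2; unfold Rsqr.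
    transitivity ((Cmod z ^ 2 - Re z ^ 2) / Cmod z ^ 2)%R; [|field; lra].
    replace (Cmod z ^ 2 - Re z ^ 2)%R with (Im z ^ 2)%R by lra; field; lra. }
unfold Carg; rewrite e; destruct (Rle_dec 0 (Im z)) as [p|p].
- rewrite Rabs_pos_eq by exact p; reflexivity.
- rewrite Rabs_left by lra; rewrite <- atan_opp; f_equal; field; lra.
Qed.

Lemma Cexp_Clog (z : C) : (0 < Re z)%R -> Cexp (Clog z) = z.
Proof.
intros h; pose proof (Cmod_pos_of_Re z h) as hm.
unfold Cexp, Clog; simpl; rewrite exp_ln by exact hm.
rewrite Carg_Re_pos by exact h; rewrite cos_atan, sin_atan.
assert (e : sqrt (1 + (Im z / Re z)²) = (Cmod z / Re z)%R).
{ replace (1 + (Im z / Re z)²)%R with ((Cmod z / Re z)²)%R.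
  - apply sqrt_Rsqr; apply Rlt_le, Rdiv_lt_0_compat; assumption.
  - pose proof (Cmod2_alt z) as e2; unfold Rsqr.
    transitivity (Cmod z ^ 2 / Re z ^ 2)%R; [field; lra|rewrite e2; field; lra]. }
rewrite e; apply Ceq; unfold Re, Im; simpl; fold (Re z) (Im z);
  field; split; lra.
Qed.

Lemma continuous_Clog (z : C) : (0 < Re z)%R ->
  forall eps, (0 < eps)%R -> exists delta, (0 < delta)%R /\
  forall s, (Cmod s < delta)%R -> (Cmod (Clog (z + s) - Clog z) < eps)%R.
Proof.
intros h eps heps; pose proof (Cmod_pos_of_Re z h) as hm.
assert (cf : continuous (fun w : C_UniformSpace => fst w) z)
  by (destruct z; apply continuous_fst).
assert (cs : continuous (fun w : C_UniformSpace => snd w) z)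
  by (destruct z; apply continuous_snd).
assert (c1 : continuous (fun w : C_UniformSpace => atan (snd w * / fst w)) z).
{ apply (continuous_comp (fun w : C_UniformSpace => (snd w * / fst w)%R) atan).
  - apply (continuous_mult (fun w : C_UniformSpace => snd w)
      (fun w : C_UniformSpace => / fst w)%R); [exact cs|].
    apply (continuous_comp (fun w : C_UniformSpace => fst w) Rinv); [exact cf|].
    apply continuous_Rinv; unfold Re in h; lra.
  - apply (ex_derive_continuous atan); auto_derive; trivial. }
assert (c2 : continuous (fun w : C_UniformSpace => ln (Cmod w)) z).
{ apply (continuous_comp (fun w : C_UniformSpace => Cmod w) ln).
  - unfold Cmod.
    apply (continuous_comp (fun w : C_UniformSpace => (fst w ^ 2 + snd w ^ 2)%R) sqrt).
    + apply (continuous_plus (fun w : C_UniformSpace => (fst w ^ 2)%R)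
        (fun w : C_UniformSpace => (snd w ^ 2)%R));
      [apply (continuous_comp (fun w : C_UniformSpace => fst w) (fun x => x ^ 2)%R)
      |apply (continuous_comp (fun w : C_UniformSpace => snd w) (fun x => x ^ 2)%R)];
      try assumption; apply (ex_derive_continuous (fun x => x ^ 2)%R); auto_derive; trivial.
    + apply continuous_sqrt.
  - apply (ex_derive_continuous ln); auto_derive; exact hm. }
assert (he2 : (0 < eps / 2)%R) by lra.
assert (b1 := proj1 (filterlim_locally _ _) c1 (mkposreal _ he2)).
assert (b2 := proj1 (filterlim_locally _ _) c2 (mkposreal _ he2)).
assert (b3 := proj1 (filterlim_locally _ _) cf (mkposreal _ h)).
destruct b1 as [d1 b1], b2 as [d2 b2], b3 as [d3 b3].
exists (Rmin d1 (Rmin d2 d3)); split.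
{ repeat apply Rmin_pos; apply cond_pos. }
intros s hs.
assert (bb : forall d : R, (Cmod s < d)%R -> @ball C_UniformSpace z d (z + s)).
{ intros d hd; apply C_NormedModule_mixin_compat1.
  change (Cmod (z + s - z) < d)%R; replace (z + s - z) with s by ring; exact hd. }
assert (hs1 : (Cmod s < d1)%R) by (eapply Rlt_le_trans; [exact hs|apply Rmin_l]).
assert (hs2 : (Cmod s < d2)%R) by (eapply Rlt_le_trans; [exact hs|];
  eapply Rle_trans; [apply Rmin_r|apply Rmin_l]).
assert (hs3 : (Cmod s < d3)%R) by (eapply Rlt_le_trans; [exact hs|];
  eapply Rle_trans; [apply Rmin_r|apply Rmin_r]).
specialize (b1 _ (bb _ hs1)); specialize (b2 _ (bb _ hs2)); specialize (b3 _ (bb _ hs3)).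
change (Rabs (atan (Im (z + s) * / Re (z + s)) - atan (Im z * / Re z)) < eps / 2)%R in b1.
change (Rabs (ln (Cmod (z + s)) - ln (Cmod z)) < eps / 2)%R in b2.
change (Rabs (Re (z + s) - Re z) < Re z)%R in b3.
assert (hp : (0 < Re (z + s))%R) by (apply Rabs_def2 in b3; lra).
eapply Rle_lt_trans; [apply Cmod_le_Re_Im|].
change (Rabs (ln (Cmod (z + s)) - ln (Cmod z)) + Rabs (Carg (z + s) - Carg z) < eps)%R.
rewrite !Carg_Re_pos by assumption; unfold Rdiv; lra.
Qed.

(** Derivative of an inverse function: the increment d of [Clog] satisfies e^d = 1 + s/z, and it is
    small by continuity, so the expansion of [Cexp] at 0 yields |s/z - d| <= e |d|. *)
Lemma is_cderive_Clog (z : C) : (0 < Re z)%R -> is_cderive Clog z (/ z).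
Proof.
intros h; pose proof (Cmod_pos_of_Re z h) as hm.
assert (hz : z <> 0) by (apply Cmod_gt_0, hm).
apply is_cderive_eps; intros eps heps.
(* e <= 1/2 turns |s/z - d| <= e |d| into |d| <= 2 |s/z|; the other bound then gives the error eps
   |s|. *)
set (e := Rmin (1 / 2) (eps * Cmod z / 2)).
assert (he : (0 < e <= 1 / 2)%R).
{ split; [apply Rmin_pos; [lra|nra]|apply Rmin_l]. }
assert (hee : (e <= eps * Cmod z / 2)%R) by apply Rmin_r.
destruct (proj1 (is_cderive_eps Cexp 0 (Cexp 0)) (is_cderive_Cexp 0) e (proj1 he))
  as [d1 [hd1 H1]].
destruct (continuous_Clog z h d1 hd1) as [d2 [hd2 H2]].
exists (Rmin d2 (Re z)); split; [apply Rmin_pos; assumption|]; intros s hs.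
assert (hs1 : (Cmod s < d2)%R) by (eapply Rlt_le_trans; [exact hs|apply Rmin_l]).
assert (hs2 : (Cmod s < Re z)%R) by (eapply Rlt_le_trans; [exact hs|apply Rmin_r]).
assert (hp : (0 < Re (z + s))%R).
{ rewrite Re_plus; pose proof (re_le_Cmod s) as r.
  assert (r' : (Rabs (Re s) < Re z)%R) by lra; apply Rabs_def2 in r'; lra. }
specialize (H2 s hs1); set (d := Clog (z + s) - Clog z) in *.
specialize (H1 d H2); rewrite Cexp_0, Cmult_1_r in H1.
replace (0 + d) with d in H1 by ring.
assert (ed : Cexp d = 1 + s / z).
{ unfold d, Cminus; rewrite Cexp_plus, Cexp_opp, !Cexp_Clog by assumption; field; exact hz. }
rewrite ed in H1; replace (1 + s / z - 1 - d) with (s / z - d) in H1 by ring.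
assert (hsz : Cmod (s / z) = (Cmod s / Cmod z)%R) by (apply Cmod_div; exact hz).
assert (hd : (Cmod d <= 2 * (Cmod s / Cmod z))%R).
{ rewrite <- hsz; pose proof (Cmod_minus_ge d (s / z)) as g.
  rewrite Cmod_minus_sym in g; pose proof (Cmod_ge_0 d); nra. }
change (Clog (z + s) - Clog z) with d.
change (s * / z) with (s / z); rewrite Cmod_minus_sym.
eapply Rle_trans; [exact H1|].
assert (hq : (0 <= Cmod s / Cmod z)%R).
{ apply Rmult_le_pos; [apply Cmod_ge_0|left; apply Rinv_0_lt_compat, hm]. }
apply Rle_trans with (eps * Cmod z / 2 * (2 * (Cmod s / Cmod z)))%R; [|right; field; lra].
apply Rmult_le_compat; try lra; apply Cmod_ge_0.
Qed.

Lemma Re_1_plus (x : C) : (1 - Cmod x <= Re (1 + x))%R.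
Proof.
rewrite Re_plus; simpl; pose proof (re_le_Cmod x) as h.
apply Rabs_le_between in h; lra.
Qed.

Lemma Cmod_1_plus (x : C) : (1 - Cmod x <= Cmod (1 + x))%R.
Proof.
eapply Rle_trans; [apply Re_1_plus|].
eapply Rle_trans; [apply Rle_abs|apply re_le_Cmod].
Qed.

Lemma Cmod_Clog_1_plus_le (x : C) : (Cmod x <= 1 / 2)%R -> (Cmod (Clog (1 + x)) <= 2 * Cmod x)%R.
Proof.
intros hx.
assert (e : Clog 1 = 0).
{ unfold Clog; rewrite Carg_Re_pos by (simpl; lra); simpl.
  rewrite Cmod_1, ln_1; unfold Rdiv; rewrite Rmult_0_l, atan_0; reflexivity. }
pose proof (cderive_increment_le Clog Cinv 1 x 2) as h; rewrite e in h.
replace (Clog (1 + x)) with (Clog (1 + x) - 0) by ring; apply h; intros t ht.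
assert (htx : (Cmod (t * x) <= 1 / 2)%R).
{ rewrite Cmod_mult, Cmod_R, Rabs_pos_eq by lra; pose proof (Cmod_ge_0 x); nra. }
pose proof (Re_1_plus (t * x)) as h1; pose proof (Cmod_1_plus (t * x)) as h2.
split; [apply is_cderive_Clog; lra|].
rewrite Cmod_inv by (apply Cmod_gt_0; lra).
replace 2%R with (/ (/ 2))%R by (field; lra).
apply Rinv_le_contravar; lra.
Qed.

(** * Lee-Yang products and branches of the logarithm *)

Lemma Re_scal (x : R) (z : C) : Re (RtoC x * z) = (x * Re z)%R.
Proof. destruct z; simpl; ring. Qed.

Lemma Csum_cons (x : C) (s : list C) : Csum (x :: s) = x + Csum s.
Proof. reflexivity. Qed.

Lemma Csum_cderive (f : C -> C -> C) (df : C -> C) (z : C) (u : list C) :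
  List.Forall (fun x => is_cderive (f x) z (df x)) u ->
  is_cderive (fun y => Csum (map (fun x => f x y) u)) z (Csum (map df u)).
Proof.
induction 1 as [|x u hx hu ih]; [exact (is_cderive_const 0 z)|].
apply (is_cderive_plus (f x) (fun y => Csum (map (fun x => f x y) u))); assumption.
Qed.

Lemma Cmod_Csum_le (f : C -> C) (u : list C) (M : R) :
  List.Forall (fun x => (Cmod (f x) <= M)%R) u ->
  (Cmod (Csum (map f u)) <= INR (length u) * M)%R.
Proof.
induction 1 as [|x u hx hu ih].
- simpl; rewrite Cmod_0; lra.
- change (length (x :: u)) with (S (length u)); rewrite S_INR; simpl map.
  rewrite Csum_cons; eapply Rle_trans; [apply Cmod_triangle|]; lra.
Qed.

Lemma Re_Csum_ge_0 (f : C -> C) (u : list C) :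
  List.Forall (fun x => (0 <= Re (f x))%R) u -> (0 <= Re (Csum (map f u)))%R.
Proof.
induction 1 as [|x u hx hu ih]; [simpl; lra|].
simpl map; rewrite Csum_cons, Re_plus; lra.
Qed.

Lemma Cmod_fugacity (h : C) : Cmod (fugacity h) = exp (- (2 * Re h)).
Proof.
unfold fugacity; rewrite Cmod_Cexp; f_equal; destruct h; simpl; ring.
Qed.

Lemma fugacity_cderive (h : C) : is_cderive fugacity h (-2 * fugacity h).
Proof.
apply (is_cderive_comp Cexp (fun h => - (2 * h))).
- apply is_cderive_Cexp.
- apply (is_cderive_ext (fun h => (-2) * h)); [intros; ring|].
  eapply is_cderive_eq;
    [apply is_cderive_mult; [apply is_cderive_const|apply is_cderive_id]|].
  rewrite Cmult_0_l, Cplus_0_l, Cmult_1_r; reflexivity.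
Qed.

Lemma disc_fugacity (x h : C) (a : R) : in_disc x -> (a <= Re h)%R ->
  (Cmod (x * fugacity h) <= exp (- (2 * a)))%R.
Proof.
unfold in_disc; intros hx ha; rewrite Cmod_mult, Cmod_fugacity.
pose proof (Cmod_ge_0 x) as h0; pose proof (exp_pos (- (2 * Re h))) as h1.
apply Rle_trans with (exp (- (2 * Re h))); [nra|].
destruct ha as [ha| ->]; [left; apply exp_increasing; lra|lra].
Qed.

Lemma exp_neg_lt_1 (a : R) : (0 < a)%R -> (exp (- (2 * a)) < 1)%R.
Proof. intros; rewrite <- exp_0; apply exp_increasing; lra. Qed.

(** The term n h is distributed over the summands: with y = x e^(-2h), h + log(1 - y) has derivative
    (1 + y)/(1 - y), a Cayley transform, and dy/dh = -2y gives the second derivative -4y/(1 -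
    y)^2. *)
Definition log_sum (u : list C) (h : C) : C :=
  Csum (map (fun x => h + Clog (1 - x * fugacity h)) u).
Definition mag_sum (u : list C) (h : C) : C :=
  Csum (map (fun x => (1 + x * fugacity h) / (1 - x * fugacity h)) u).
Definition dmag_sum (u : list C) (h : C) : C :=
  Csum (map (fun x =>
    -4 * (x * fugacity h) / ((1 - x * fugacity h) * (1 - x * fugacity h))) u).

Lemma Re_1_minus (x : C) : (1 - Cmod x <= Re (1 - x))%R.
Proof. unfold Cminus; rewrite <- (Cmod_opp x); apply Re_1_plus. Qed.

Lemma Cmod_1_minus (x : C) : (1 - Cmod x <= Cmod (1 - x))%R.
Proof. unfold Cminus; rewrite <- (Cmod_opp x); apply Cmod_1_plus. Qed.

Lemma factor_pos (x h : C) : in_disc x -> (0 < Re h)%R ->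
  (0 < Re (1 - x * fugacity h))%R.
Proof.
intros hx hh; pose proof (disc_fugacity x h (Re h) hx (Rle_refl _)).
pose proof (exp_neg_lt_1 _ hh); pose proof (Re_1_minus (x * fugacity h)); lra.
Qed.

Lemma factor_neq_0 (x h : C) : in_disc x -> (0 < Re h)%R -> 1 - x * fugacity h <> 0.
Proof. intros hx hh; apply Cmod_gt_0, Cmod_pos_of_Re, factor_pos; assumption. Qed.

Lemma factor_cderive (x h : C) :
  is_cderive (fun h => 1 - x * fugacity h) h (2 * (x * fugacity h)).
Proof.
eapply is_cderive_eq.
- apply is_cderive_minus; [apply is_cderive_const|].
  apply is_cderive_mult; [apply is_cderive_const|apply fugacity_cderive].
- simpl; ring.
Qed.

Lemma log_sum_cderive (u : list C) (h : C) : List.Forall in_disc u -> (0 < Re h)%R ->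
  is_cderive (log_sum u) h (mag_sum u h).
Proof.
intros hu hh; apply (Csum_cderive (fun x h => h + Clog (1 - x * fugacity h))).
eapply List.Forall_impl; [|exact hu]; intros x hx.
eapply is_cderive_eq.
- apply is_cderive_plus; [apply is_cderive_id|].
  apply (is_cderive_comp Clog (fun h => 1 - x * fugacity h));
    [apply is_cderive_Clog, factor_pos; assumption|apply factor_cderive].
- pose proof (factor_neq_0 x h hx hh); field; assumption.
Qed.

Lemma mag_sum_cderive (u : list C) (h : C) : List.Forall in_disc u -> (0 < Re h)%R ->
  is_cderive (mag_sum u) h (dmag_sum u h).
Proof.
intros hu hh.
apply (Csum_cderive (fun x h => (1 + x * fugacity h) / (1 - x * fugacity h))
  (fun x => -4 * (x * fugacity h) / ((1 - x * fugacity h) * (1 - x * fugacity h)))).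
eapply List.Forall_impl; [|exact hu]; intros x hx; cbv beta.
pose proof (factor_neq_0 x h hx hh) as nz.
eapply is_cderive_eq.
- apply is_cderive_mult.
  + apply is_cderive_plus; [apply is_cderive_const|].
    apply is_cderive_mult; [apply is_cderive_const|apply fugacity_cderive].
  + apply (is_cderive_comp Cinv (fun h => 1 - x * fugacity h));
      [apply is_cderive_Cinv, nz|apply factor_cderive].
- cbv beta; field; exact nz.
Qed.

Lemma Cexp_log_sum (u : list C) (h : C) : List.Forall in_disc u -> (0 < Re h)%R ->
  Cexp (log_sum u h) =
  Cexp (RtoC (INR (length u)) * h) * Cprod (fun x => 1 - x * fugacity h) u.
Proof.
intros hu hh; rewrite <- Cprod_Cexp_scal; unfold log_sum.
induction hu as [|x u hx hu ih]; [apply Cexp_0|].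
simpl map; rewrite Csum_cons, Cexp_plus, ih, Cexp_plus, Cexp_Clog
  by (apply factor_pos; assumption); reflexivity.
Qed.

Section Bounds.

Variables (u : list C) (a : R) (h : C).
Hypotheses (hu : List.Forall in_disc u) (ha : (0 < a)%R) (hh : (a <= Re h)%R).

Let r := exp (- (2 * a)).

(** Re((1 + y)/(1 - y)) = (1 - |y|^2)/|1 - y|^2 >= 0 for |y| <= 1. *)
Lemma Re_mag_sum_ge_0 : (0 <= Re (mag_sum u h))%R.
Proof.
apply Re_Csum_ge_0; eapply List.Forall_impl; [|exact hu]; intros x hx; cbv beta.
pose proof (disc_fugacity x h a hx hh) as b; pose proof (exp_neg_lt_1 a ha) as b1.
set (y := x * fugacity h) in *.
pose proof (factor_neq_0 x h hx (Rlt_le_trans _ _ _ ha hh)) as nz; fold y in nz.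
assert (e : (1 + y) / (1 - y) = RtoC (/ (Cmod (1 - y) ^ 2)) * ((1 + y) * Cconj (1 - y))).
{ assert (hm : Cmod (1 - y) <> 0%R) by (apply Rgt_not_eq, Cmod_gt_0, nz).
  rewrite RtoC_inv, Cmod2_conj by (apply pow_nonzero; exact hm).
  field; split; [|exact nz].
  intros c; apply nz; rewrite <- (Cconj_conj (1 - y)), c; apply Ceq; simpl; ring. }
rewrite e, Re_scal.
replace (Re ((1 + y) * Cconj (1 - y))) with (1 - Cmod y ^ 2)%R
  by (rewrite Cmod2_alt; unfold Re, Im; destruct y; simpl; ring).
apply Rmult_le_pos.
- left; apply Rinv_0_lt_compat, pow_lt, Cmod_gt_0, nz.
- pose proof (Cmod_ge_0 y); nra.
Qed.

Lemma factor_Cmod_ge (x : C) : in_disc x -> (1 - r <= Cmod (1 - x * fugacity h))%R.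
Proof.
intros hx; pose proof (disc_fugacity x h a hx hh) as b.
pose proof (Cmod_1_minus (x * fugacity h)); unfold r; lra.
Qed.

(** Each term is at most 2/(1 - r); the weaker constant is shared with the bound for [dmag_sum]. *)
Lemma Cmod_mag_sum_le : (Cmod (mag_sum u h) <= INR (length u) * (4 / (1 - r) ^ 2))%R.
Proof.
apply Cmod_Csum_le; eapply List.Forall_impl; [|exact hu]; intros x hx; cbv beta.
pose proof (disc_fugacity x h a hx hh) as b; pose proof (exp_neg_lt_1 a ha) as b1.
pose proof (exp_pos (- (2 * a))) as b0.
pose proof (factor_Cmod_ge x hx) as fg; fold r in b, b1, b0.
pose proof (factor_neq_0 x h hx (Rlt_le_trans _ _ _ ha hh)) as nz.
rewrite Cmod_div by exact nz.
apply Rle_trans with (2 / (1 - r))%R.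
- apply Rmult_le_compat; [apply Cmod_ge_0|left; apply Rinv_0_lt_compat; lra| |].
  + eapply Rle_trans; [apply Cmod_triangle|]; rewrite Cmod_1; lra.
  + apply Rinv_le_contravar; lra.
- replace (2 / (1 - r))%R with (2 * (1 - r) / (1 - r) ^ 2)%R by (field; lra).
  apply Rmult_le_compat_r; [left; apply Rinv_0_lt_compat, pow_lt; lra|lra].
Qed.

Lemma Cmod_dmag_sum_le : (Cmod (dmag_sum u h) <= INR (length u) * (4 / (1 - r) ^ 2))%R.
Proof.
apply Cmod_Csum_le; eapply List.Forall_impl; [|exact hu]; intros x hx; cbv beta.
pose proof (disc_fugacity x h a hx hh) as b; pose proof (exp_neg_lt_1 a ha) as b1.
pose proof (exp_pos (- (2 * a))) as b0.
pose proof (factor_Cmod_ge x hx) as fg; fold r in b, b1, b0.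
pose proof (factor_neq_0 x h hx (Rlt_le_trans _ _ _ ha hh)) as nz.
rewrite Cmod_div, Cmod_mult, (Cmod_mult (1 - x * fugacity h))
  by (apply Cmult_neq_0; exact nz).
rewrite Cmod_R, Rabs_left by lra.
apply Rmult_le_compat.
- apply Rmult_le_pos; [lra|apply Cmod_ge_0].
- left; apply Rinv_0_lt_compat, Rmult_lt_0_compat; lra.
- lra.
- apply Rinv_le_contravar; [apply pow_lt; lra|nra].
Qed.

(** Behaviour for large Re h, where all factors approach 1. It serves twice: to pin down the branch
    on the real axis and to anchor the free energy at infinity. *)
Lemma log_sum_asymptotics : (r <= 1 / 2)%R ->
  (Cmod (log_sum u h - RtoC (INR (length u)) * h) <= INR (length u) * (2 * r))%R.
Proof.
intros hr.
replace (log_sum u h - RtoC (INR (length u)) * h)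
  with (Csum (map (fun x => Clog (1 - x * fugacity h)) u)).
- apply Cmod_Csum_le; eapply List.Forall_impl; [|exact hu]; intros x hx; cbv beta.
  pose proof (disc_fugacity x h a hx hh) as b; fold r in b.
  unfold Cminus; eapply Rle_trans;
    [apply Cmod_Clog_1_plus_le|]; rewrite Cmod_opp; lra.
- unfold log_sum; clear hu; induction u as [|x v ih]; [simpl; ring|].
  change (length (x :: v)) with (S (length v)); rewrite S_INR, RtoC_plus.
  simpl map; rewrite !Csum_cons, ih; ring.
Qed.

Lemma mag_sum_asymptotics : (r <= 1 / 2)%R ->
  (Cmod (RtoC (INR (length u)) - mag_sum u h) <= INR (length u) * (4 * r))%R.
Proof.
intros hr.
replace (RtoC (INR (length u)) - mag_sum u h)
  with (Csum (map (fun x => 1 - (1 + x * fugacity h) / (1 - x * fugacity h)) u)).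
- apply Cmod_Csum_le; eapply List.Forall_impl; [|exact hu]; intros x hx; cbv beta.
  pose proof (disc_fugacity x h a hx hh) as b; fold r in b.
  pose proof (factor_Cmod_ge x hx) as fg.
  pose proof (factor_neq_0 x h hx (Rlt_le_trans _ _ _ ha hh)) as nz.
  replace (1 - (1 + x * fugacity h) / (1 - x * fugacity h))
    with ((-2) * (x * fugacity h) / (1 - x * fugacity h)) by (field; exact nz).
  rewrite Cmod_div, Cmod_mult, Cmod_R, Rabs_left by (lra || exact nz).
  apply Rle_trans with (2 * r * 2)%R; [|lra].
  apply Rmult_le_compat.
  + apply Rmult_le_pos; [lra|apply Cmod_ge_0].
  + left; apply Rinv_0_lt_compat; lra.
  + lra.
  + replace 2%R with (/ (/ 2))%R by field; apply Rinv_le_contravar; lra.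
- unfold mag_sum; clear hu; induction u as [|x v ih]; [simpl; ring|].
  change (length (x :: v)) with (S (length v)); rewrite S_INR, RtoC_plus.
  simpl map; rewrite !Csum_cons, ih; ring.
Qed.

End Bounds.

(** * Uniqueness of the logarithm branch *)

(** Differentiating sin theta = 0 gives theta' cos theta = 0, and the cosine is 1 or -1 there. The
    margin c < a makes the derivative at a two-sided. *)
Lemma sin_zero_constant (theta : R -> R) (c a b : R) : (c < a <= b)%R ->
  (forall t, (c < t)%R -> ex_derive theta t /\ sin (theta t) = 0%R) ->
  theta a = theta b.
Proof.
intros hab h.
assert (d : forall t, (c < t)%R -> is_derive theta t 0).
{ intros t ht; destruct (h t ht) as [[l hl] s0].
  assert (d1 : is_derive (fun t => sin (theta t)) t (l * cos (theta t))%R).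
  { apply (is_derive_comp sin theta); [|exact hl].
    apply is_derive_Reals, derivable_pt_lim_sin. }
  assert (d0 : is_derive (fun t => sin (theta t)) t 0).
  { apply (is_derive_ext_loc (fun _ => 0%R)).
    - assert (p : (0 < t - c)%R) by lra.
      exists (mkposreal _ p); intros y hy; symmetry; apply h.
      change (Rabs (y - t) < t - c)%R in hy; apply Rabs_def2 in hy; lra.
    - exact (@is_derive_const R_AbsRing R_NormedModule 0%R t). }
  apply is_derive_unique in d1; apply is_derive_unique in d0; rewrite d0 in d1.
  assert (hc : cos (theta t) <> 0%R).
  { pose proof (sin2_cos2 (theta t)) as e; unfold Rsqr in e; rewrite s0 in e.
    intros c0; rewrite c0 in e; lra. }
  replace 0%R with l; [exact hl|].
  symmetry in d1; apply Rmult_integral in d1; tauto. }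
destruct (MVT_gen theta a b (fun _ => 0%R)) as [x [_ e]].
- intros x; rewrite Rmin_left by lra; intros hx; apply d; lra.
- intros x; rewrite Rmin_left by lra; intros hx.
  apply continuity_pt_filterlim, (ex_derive_continuous theta); eexists; apply d; lra.
- lra.
Qed.

Lemma is_cderive_path_Im (f : C -> C) (a v l : C) (t : R) :
  is_cderive f (a + RtoC t * v) l ->
  is_derive (fun t : R => Im (f (a + RtoC t * v))) t (Im (v * l)).
Proof.
intros hf.
assert (hg : is_cderive (fun z => - Ci * f z) (a + RtoC t * v) (- Ci * l)).
{ eapply is_cderive_eq.
  - apply is_cderive_mult; [apply is_cderive_const|exact hf].
  - rewrite Cmult_0_l, Cplus_0_l; reflexivity. }
apply is_cderive_path in hg.
replace (Im (v * l)) with (Re (v * (- Ci * l)))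
  by (destruct v, l; simpl; ring).
eapply is_derive_ext; [|exact hg]; intros s; cbv beta.
destruct (f (a + s * v)); simpl; ring.
Qed.

(** The difference of two branches has real part 0 and imaginary part in pi Z. Along the vertical
    line through h, which stays in the half-plane, that imaginary part is constant, and it vanishes
    on the real axis. *)
Lemma log_branch_unique (F L1 L2 : C -> C) (h : C) : (0 < Re h)%R ->
  is_log_branch F L1 -> is_log_branch F L2 -> L1 h = L2 h.
Proof.
intros hh h1 h2.
assert (e : forall z, (0 < Re z)%R -> Cexp (L1 z - L2 z) = 1).
{ intros z hz; unfold Cminus; rewrite Cexp_plus, Cexp_opp.
  destruct (h1 z hz) as [_ [-> _]]; destruct (h2 z hz) as [_ [<- _]].
  apply Cinv_r, Cexp_neq_0. }
assert (hre : forall t : R, Re (RtoC (Re h) + RtoC t * (Ci * RtoC (Im h))) = Re h)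
  by (intros; simpl; ring).
assert (s : forall z, (0 < Re z)%R -> Re (L1 z - L2 z) = 0%R /\ sin (Im (L1 z - L2 z)) = 0%R).
{ intros z hz; specialize (e z hz).
  assert (em : exp (Re (L1 z - L2 z)) = 1%R) by (rewrite <- Cmod_Cexp, e; apply Cmod_1).
  split.
  - apply exp_inv; rewrite em, exp_0; reflexivity.
  - apply (f_equal snd) in e; unfold Cexp in e; simpl snd in e.
    change (exp (Re (L1 z - L2 z)) * sin (Im (L1 z - L2 z)) = 0)%R in e.
    rewrite em in e; lra. }
pose proof (sin_zero_constant
  (fun t => Im (L1 (RtoC (Re h) + RtoC t * (Ci * RtoC (Im h)))
    - L2 (RtoC (Re h) + RtoC t * (Ci * RtoC (Im h))))) (-1) 0 1) as k.
cbv beta in k.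
assert (e1 : RtoC (Re h) + RtoC 1 * (Ci * RtoC (Im h)) = h)
  by (apply Ceq; simpl; ring).
assert (e0 : RtoC (Re h) + RtoC 0 * (Ci * RtoC (Im h)) = RtoC (Re h))
  by (apply Ceq; simpl; ring).
rewrite e1, e0 in k.
assert (i0 : Im (L1 (RtoC (Re h)) - L2 (RtoC (Re h))) = 0%R).
{ destruct (h1 (RtoC (Re h)) hh) as [_ [_ i1]].
  destruct (h2 (RtoC (Re h)) hh) as [_ [_ i2]].
  specialize (i1 eq_refl); specialize (i2 eq_refl); unfold Im in *; simpl; lra. }
assert (i1 : Im (L1 h - L2 h) = 0%R).
{ rewrite <- k, i0; [reflexivity|lra|]; intros t _; split.
  - destruct (h1 (RtoC (Re h) + RtoC t * (Ci * RtoC (Im h)))) as [d1 _];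
      [rewrite hre; exact hh|]; apply ex_derive_cderive in d1; destruct d1 as [l1 d1].
    destruct (h2 (RtoC (Re h) + RtoC t * (Ci * RtoC (Im h)))) as [d2 _];
      [rewrite hre; exact hh|]; apply ex_derive_cderive in d2; destruct d2 as [l2 d2].
    eexists; apply (is_cderive_path_Im (fun z => L1 z - L2 z)).
    apply is_cderive_minus; [exact d1|exact d2].
  - apply s; rewrite hre; exact hh. }
destruct (s h hh) as [r0 _].
apply Ceq; unfold Re, Im in *; simpl in *; lra.
Qed.

Lemma log_branch_eq (F L : C -> C) (h : C) :
  is_log_branch F L -> (0 < Re h)%R -> log_branch F h = L h.
Proof.
intros hL hh; apply (log_branch_unique F); [exact hh| |exact hL].
unfold log_branch; apply epsilon_spec; exists L; exact hL.
Qed.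

(** * Finite systems *)

Lemma exp_small (a eta : R) : (0 < a)%R -> (0 < eta)%R ->
  exists T, (0 < T)%R /\ (exp (- (2 * (a + T))) <= eta)%R.
Proof.
intros ha he; exists (Rmax 1 (- ln eta)); split.
{ eapply Rlt_le_trans; [apply Rlt_0_1|apply Rmax_l]. }
pose proof (Rmax_l 1 (- ln eta)); pose proof (Rmax_r 1 (- ln eta)).
rewrite <- (exp_ln eta he) at 2.
apply Rlt_le, exp_increasing; lra.
Qed.

Lemma Cmult_cancel_l (x y z : C) : x <> 0 -> x * y = x * z -> y = z.
Proof.
intros hx e; rewrite <- (Cmult_1_l y), <- (Cmult_1_l z), <- (Cinv_l x hx).
rewrite <- !Cmult_assoc, e; reflexivity.
Qed.

Lemma RtoC_scal_inv (x : R) (z : C) : (0 < x)%R -> RtoC x * (RtoC (/ x) * z) = z.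
Proof. intros hx; rewrite Cmult_assoc, <- RtoC_mult, Rinv_r by lra; ring. Qed.

Lemma is_cderive_ext_right (f g : C -> C) (z l : C) : (0 < Re z)%R ->
  (forall y, (0 < Re y)%R -> f y = g y) -> is_cderive f z l -> is_cderive g z l.
Proof.
intros hz e; rewrite !is_cderive_eps; intros h eps heps.
destruct (h eps heps) as [d [hd H]].
exists (Rmin d (Re z)); split; [apply Rmin_pos; assumption|]; intros s hs.
rewrite <- !e; [apply H|exact hz|].
- eapply Rlt_le_trans; [exact hs|apply Rmin_l].
- pose proof (re_le_Cmod s) as r; pose proof (Rmin_r d (Re z)).
  assert (r' : (Rabs (Re s) < Re z)%R) by lra.
  apply Rabs_def2 in r'; rewrite Re_plus; lra.
Qed.

Lemma weight_cderive (J s : R) (h : C) :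
  is_cderive (fun h => weight J h s) h (RtoC s * weight J h s).
Proof.
apply (is_cderive_comp Cexp (fun h => RtoC (J / 2 * s ^ 2)%R + h * RtoC s));
  [apply is_cderive_Cexp|].
eapply is_cderive_eq.
- apply is_cderive_plus; [apply is_cderive_const|].
  apply is_cderive_mult; [apply is_cderive_id|apply is_cderive_const].
- cbv beta; ring.
Qed.

Lemma spin_sum_cderive (n : nat) (phi : R -> C -> C) (dphi : R -> C) (z : C) :
  (forall s, is_cderive (phi s) z (dphi s)) ->
  is_cderive (fun h => spin_sum n (fun s => phi s h)) z (spin_sum n dphi).
Proof.
revert phi dphi; induction n as [|n ih]; intros phi dphi hd.
- rewrite spin_sum_0; eapply is_cderive_ext; [|apply hd].
  intros y; rewrite spin_sum_0; reflexivity.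
- rewrite spin_sum_S; eapply is_cderive_ext.
  + intros y; symmetry; apply (spin_sum_S n (fun s => phi s y)).
  + apply is_cderive_plus;
    [apply (ih (fun s => phi (1 + s)%R))|apply (ih (fun s => phi (-1 + s)%R))];
    intros; apply hd.
Qed.

Lemma spin_pf_cderive (n : nat) (J : R) (h : C) :
  is_cderive (spin_pf n J) h (spin_sum n (fun s => RtoC s * weight J h s)).
Proof. apply (spin_sum_cderive n (fun s h => weight J h s)); intros; apply weight_cderive. Qed.

(** The conclusion of [lee_yang] with the list as an argument, so that one list can be fixed through
    a section. *)
Definition lee_yang_data (n : nat) (J : R) (u : list C) : Prop :=
  length u = n /\ List.Forall in_disc u /\
  forall h, spin_pf n J h =
    Cexp (RtoC (J / 2 * INR n ^ 2)%R + RtoC (INR n) * h)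
    * Cprod (fun x => 1 - x * fugacity h) u.

Section LeeYangData.

Variables (n : nat) (J : R) (u : list C).
Hypothesis hu : lee_yang_data n J u.

Definition log_pf (h : C) : C := RtoC (J / 2 * INR n ^ 2)%R + log_sum u h.

Lemma Cexp_log_pf (h : C) : (0 < Re h)%R -> Cexp (log_pf h) = spin_pf n J h.
Proof.
destruct hu as [hl [hd e]]; intros hh; unfold log_pf.
rewrite Cexp_plus, Cexp_log_sum, hl, e, Cexp_plus by assumption; ring.
Qed.

Lemma spin_pf_neq_0 (h : C) : (0 < Re h)%R -> spin_pf n J h <> 0.
Proof. intros hh; rewrite <- Cexp_log_pf by exact hh; apply Cexp_neq_0. Qed.

Lemma log_pf_cderive (h : C) : (0 < Re h)%R -> is_cderive log_pf h (mag_sum u h).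
Proof.
destruct hu as [hl [hd e]]; intros hh; eapply is_cderive_eq.
- apply is_cderive_plus; [apply is_cderive_const|apply log_sum_cderive; assumption].
- cbv beta; ring.
Qed.

(** Compared with [spin_pf_cderive], uniqueness of derivatives identifies [mag_sum u] with the spin
    average of the total magnetization. *)
Lemma spin_pf_log_cderive (h : C) : (0 < Re h)%R ->
  is_cderive (spin_pf n J) h (mag_sum u h * spin_pf n J h).
Proof.
intros hh; apply (is_cderive_ext_right (fun h => Cexp (log_pf h)));
  [exact hh|apply Cexp_log_pf|].
rewrite <- Cexp_log_pf by exact hh.
apply (is_cderive_comp Cexp log_pf); [apply is_cderive_Cexp|apply log_pf_cderive, hh].
Qed.

Lemma Im_spin_pf_real (h : C) : Im h = 0%R -> Im (spin_pf n J h) = 0%R.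
Proof.
intros hh; unfold spin_pf.
assert (w : forall s, Im (weight J h s) = 0%R).
{ intros s; unfold weight.
  replace (RtoC (J / 2 * s ^ 2)%R + h * RtoC s) with (RtoC (J / 2 * s ^ 2 + Re h * s)%R)
    by (apply Ceq; destruct h; simpl in *; try rewrite hh; simpl; ring).
  rewrite Cexp_RtoC; reflexivity. }
revert w; generalize (weight J h); clear hu; induction n as [|k ih]; intros phi w.
- rewrite spin_sum_0; apply w.
- rewrite spin_sum_S.
  change (Im (spin_sum k (fun s => phi (1 + s)%R)) + Im (spin_sum k (fun s => phi (-1 + s)%R)) = 0)%R.
  rewrite !ih by (intros; apply w); lra.
Qed.

(** The data do not say that [u] is stable under conjugation, so reality is not read off the
    summands. Instead: the partition function is real on the real axis, hence the imaginary part of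
    its logarithm is constant along it, and it tends to 0 at infinity. *)
Lemma Im_log_pf_real (h : C) : (0 < Re h)%R -> Im h = 0%R -> Im (log_pf h) = 0%R.
Proof.
intros hh hi; destruct hu as [hl [hd _]].
assert (re : forall t : R, Re (h + RtoC t * 1) = (Re h + t)%R)
  by (intros; destruct h; simpl; ring).
assert (im : forall t : R, Im (h + RtoC t * 1) = 0%R)
  by (intros; destruct h; simpl in *; rewrite hi; ring).
destruct (Req_dec (Im (log_pf h)) 0) as [|nz]; [assumption|exfalso].
set (eps := Rabs (Im (log_pf h))).
assert (he : (0 < eps)%R) by (apply Rabs_pos_lt; exact nz).
assert (hn : (0 <= INR n)%R) by apply pos_INR.
(* At distance T the imaginary part is at most 2 n eps / (4 (n + 1)) < eps, a contradiction; n + 1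
   avoids a zero denominator. *)
destruct (exp_small (Re h) (Rmin (1 / 2) (eps / (4 * (INR n + 1)))) hh) as [T [hT hx]].
{ apply Rmin_pos; [lra|apply Rdiv_lt_0_compat; lra]. }
pose proof (sin_zero_constant (fun t => Im (log_pf (h + RtoC t * 1))) (- Re h) 0 T) as k.
cbv beta in k; replace (h + RtoC 0 * 1) with h in k by ring.
assert (k' : Im (log_pf h) = Im (log_pf (h + RtoC T * 1))).
{ apply k; [lra|]; intros t ht.
  assert (hp : (0 < Re (h + RtoC t * 1))%R) by (rewrite re; lra).
  split.
  - eexists; apply is_cderive_path_Im, log_pf_cderive, hp.
  - pose proof (Cexp_log_pf _ hp) as e; apply (f_equal Im) in e.
    rewrite Im_spin_pf_real in e by apply im.
    change (exp (Re (log_pf (h + RtoC t * 1))) * sin (Im (log_pf (h + RtoC t * 1))) = 0)%R in e.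
    apply Rmult_integral in e; destruct e as [e|e]; [|exact e].
    pose proof (exp_pos (Re (log_pf (h + RtoC t * 1)))); lra. }
assert (b : (Cmod (log_sum u (h + RtoC T * 1) - RtoC (INR n) * (h + RtoC T * 1))
  <= INR n * (2 * exp (- (2 * (Re h + T)))))%R).
{ rewrite <- hl; apply log_sum_asymptotics; [exact hd|rewrite re; lra|].
  eapply Rle_trans; [exact hx|apply Rmin_l]. }
assert (c : (eps <= INR n * (2 * exp (- (2 * (Re h + T)))))%R).
{ eapply Rle_trans; [|exact b]; eapply Rle_trans; [|apply Im_le_Cmod].
  right; unfold eps; f_equal; rewrite k'; unfold log_pf.
  replace (Im (log_sum u (h + RtoC T * 1) - RtoC (INR n) * (h + RtoC T * 1)))
    with (Im (log_sum u (h + RtoC T * 1)) - INR n * Im (h + RtoC T * 1))%R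
    by (unfold Im; simpl; ring).
  rewrite im; unfold Im; simpl; ring. }
assert (d : (exp (- (2 * (Re h + T))) * (4 * (INR n + 1)) <= eps)%R).
{ apply Rle_trans with (eps / (4 * (INR n + 1)) * (4 * (INR n + 1)))%R;
    [|right; field; lra].
  apply Rmult_le_compat_r; [lra|]; eapply Rle_trans; [exact hx|apply Rmin_r]. }
pose proof (exp_pos (- (2 * (Re h + T)))); nra.
Qed.

Lemma log_pf_is_log_branch : is_log_branch (spin_pf n J) log_pf.
Proof.
intros h hh; split; [|split].
- apply ex_derive_cderive; eexists; apply log_pf_cderive, hh.
- apply Cexp_log_pf, hh.
- apply Im_log_pf_real, hh.
Qed.

End LeeYangData.

(** * Mean-field equation and free energy at finite size, with explicit errors *)

Lemma shift_up_cderive (f df : C -> C) (J h : C) :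
  is_cderive f (h + J) (df (h + J)) -> is_cderive (fun h => f (h + J)) h (df (h + J)).
Proof.
intros hf; eapply is_cderive_eq.
- apply (is_cderive_comp f (fun h => h + J)); [exact hf|].
  apply is_cderive_plus; [apply is_cderive_id|apply is_cderive_const].
- cbv beta; ring.
Qed.

Definition ctanh (y : C) : C := (1 - fugacity y) / (1 + fugacity y).

(** This is log(2 cosh(h + beta M)) - beta M^2 / 2, rearranged so that the logarithm is a principal
    one near 1 + e^(-2y). Its M-derivative is beta (tanh(h + beta M) - M), so it is stationary at
    solutions of the mean-field equation. *)
Definition free_energy (beta : R) (h M : C) : C :=
  RtoC (beta / 2) + h + Clog (1 + fugacity (h + RtoC beta * M))
  - RtoC (beta / 2) * ((1 - M) * (1 - M)).

Section FiniteSize.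

Variables (beta a : R) (k : nat) (u v : list C).
Let n := S k.
Let J := (beta / INR n)%R.
Hypotheses (hbeta : (0 < beta)%R) (ha : (0 < a)%R) (hk : (1 <= k)%nat)
  (hJ : (J <= a / 2)%R) (hu : lee_yang_data n J u) (hv : lee_yang_data k J v).

(** [K] bounds both magnetizations and their derivatives for Re h >= a/2, whence exp(- a) = exp(- 2
    (a/2)). [J * K2] bounds the error in the logarithm of the up/down ratio, [J * K3] that in the
    mean-field equation. *)
Let K := (4 / (1 - exp (- a)) ^ 2)%R.
Let K2 := (2 * beta * K + 2 * beta * ((1 + K) * K) + 2 * K)%R.
Let K3 := ((1 + K) * (exp (a * K2) * K2) / (1 - exp (- a)))%R.
Let m (h : C) : C := RtoC (/ INR n) * mag_sum u h.
Let m' (h : C) : C := RtoC (/ INR k) * mag_sum v h.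

Lemma INR_n_pos : (0 < INR n)%R.
Proof. apply lt_0_INR; unfold n; lia. Qed.

Lemma INR_k_pos : (0 < INR k)%R.
Proof. apply lt_0_INR; lia. Qed.

Lemma coupling_pos : (0 < J)%R.
Proof. apply Rdiv_lt_0_compat; [exact hbeta|apply INR_n_pos]. Qed.

Lemma coupling_k : (J * INR k = beta - J)%R.
Proof.
pose proof INR_n_pos as hn; unfold J, n in *; rewrite S_INR in *; field; lra.
Qed.

Lemma mag_bounds (w : list C) (l : nat) (h : C) : (0 < INR l)%R ->
  length w = l -> List.Forall in_disc w -> (a / 2 <= Re h)%R ->
  (Cmod (RtoC (/ INR l) * mag_sum w h) <= K)%R /\
  (Cmod (RtoC (/ INR l) * dmag_sum w h) <= K)%R /\
  is_cderive (fun h => RtoC (/ INR l) * mag_sum w h) h (RtoC (/ INR l) * dmag_sum w h).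
Proof.
intros hl e hw hh.
assert (er : K = (4 / (1 - exp (- (2 * (a / 2)))) ^ 2)%R)
  by (unfold K; do 5 f_equal; field).
split; [|split].
- rewrite Cmod_mult, Cmod_R, Rabs_pos_eq by (left; apply Rinv_0_lt_compat, hl).
  pose proof (Cmod_mag_sum_le w (a / 2) h hw ltac:(lra) hh) as b; rewrite e, <- er in b.
  apply Rmult_le_reg_l with (INR l); [exact hl|].
  rewrite <- Rmult_assoc, Rinv_r, Rmult_1_l by lra; exact b.
- rewrite Cmod_mult, Cmod_R, Rabs_pos_eq by (left; apply Rinv_0_lt_compat, hl).
  pose proof (Cmod_dmag_sum_le w (a / 2) h hw ltac:(lra) hh) as b; rewrite e, <- er in b.
  apply Rmult_le_reg_l with (INR l); [exact hl|].
  rewrite <- Rmult_assoc, Rinv_r, Rmult_1_l by lra; exact b.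
- eapply is_cderive_eq.
  + apply is_cderive_mult; [apply is_cderive_const|apply mag_sum_cderive; [exact hw|lra]].
  + cbv beta; ring.
Qed.

Lemma mag_bound_pos : (0 < K)%R.
Proof.
unfold K; apply Rdiv_lt_0_compat; [lra|apply pow_lt].
pose proof (exp_increasing (- a) 0) as h; rewrite exp_0 in h; lra.
Qed.

Lemma m'_lipschitz (h s : C) : (a / 2 <= Re h)%R -> (a / 2 <= Re (h + s))%R ->
  (Cmod (m' (h + s)%C - m' h) <= K * Cmod s)%R.
Proof.
intros h0 h1; destruct hv as [hl [hd _]].
apply (cderive_increment_le m' (fun h => RtoC (/ INR k) * dmag_sum v h)).
intros t ht.
assert (ht' : (a / 2 <= Re (h + t * s))%R).
{ rewrite Re_plus, Re_scal in *; nra. }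
destruct (mag_bounds v k (h + t * s) INR_k_pos hl hd ht') as [_ [b d]].
split; assumption.
Qed.

Section Point.

Variable h : C.
Hypothesis hh : (a <= Re h)%R.

Let X := pf_up k J h.
Let X' := pf_down k J h.
Let Z := spin_pf n J h.

Lemma total_pf_neq_0 : Z <> 0.
Proof. apply (spin_pf_neq_0 n J u hu); lra. Qed.

(** Two expressions for the derivative of the partition function are equated: the one from the
    Lee-Yang product and the first moment. *)
Lemma mag_n_eq : m h * Z = X - X'.
Proof.
pose proof (is_cderive_unique _ _ _ _ (spin_pf_log_cderive n J u hu h ltac:(lra))
  (spin_pf_cderive n J h)) as e.
pose proof (spin_pf_first_moment k J h) as e2; fold n X X' in e2.
rewrite e2 in e; fold Z in e.
unfold m; rewrite <- Cmult_assoc, e, Cmult_assoc, <- RtoC_mult, Rinv_l;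
  [ring|pose proof INR_n_pos; lra].
Qed.

Lemma pf_up_eq : X = (1 + m h) / 2 * Z.
Proof.
pose proof mag_n_eq as e; pose proof (spin_pf_S k J h) as e'; fold n X X' Z in e'.
replace ((1 + m h) / 2 * Z) with ((Z + m h * Z) / 2) by field.
rewrite e, e'; field.
Qed.

Lemma pf_down_eq : X' = (1 - m h) / 2 * Z.
Proof.
pose proof mag_n_eq as e; pose proof (spin_pf_S k J h) as e'; fold n X X' Z in e'.
replace ((1 - m h) / 2 * Z) with ((Z - m h * Z) / 2) by field.
rewrite e, e'; field.
Qed.

Lemma Re_shift : Re (h + RtoC J) = (Re h + J)%R /\ Re (h - RtoC J) = (Re h - J)%R.
Proof. destruct h; simpl; split; ring. Qed.

(** Differentiating Z = X + X' gives n m Z = X (1 + k m'(h + J)) + X' (-1 + k m'(h - J)). The terms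
    without k add up to X - X' = m Z, and n - 1 = k, so the factor k Z cancels. *)
Lemma mag_recursion :
  m h = (1 + m h) / 2 * m' (h + RtoC J) + (1 - m h) / 2 * m' (h - RtoC J).
Proof.
pose proof coupling_pos as hJp; destruct Re_shift as [r1 r2].
pose proof (spin_pf_log_cderive n J u hu h ltac:(lra)) as d1.
assert (d2 : is_cderive (spin_pf n J) h
  (X * (1 + mag_sum v (h + RtoC J)) + X' * (-1 + mag_sum v (h - RtoC J)))).
{ eapply is_cderive_ext; [intros y; symmetry; apply spin_pf_S|].
  eapply is_cderive_eq.
  - apply is_cderive_plus.
    + apply is_cderive_mult.
      * apply is_cderive_mult; [apply is_cderive_const|apply is_cderive_Cexp].
      * apply (shift_up_cderive (spin_pf k J) (fun h => mag_sum v h * spin_pf k J h)).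
        apply (spin_pf_log_cderive k J v hv); lra.
    + apply is_cderive_mult.
      * apply is_cderive_mult; [apply is_cderive_const|].
        apply (is_cderive_comp Cexp (fun h => - h)); [apply is_cderive_Cexp|].
        apply (is_cderive_ext (fun h => (-1) * h)); [intros; ring|].
        apply is_cderive_mult; [apply is_cderive_const|apply is_cderive_id].
      * apply (shift_up_cderive (spin_pf k J) (fun h => mag_sum v h * spin_pf k J h)).
        apply (spin_pf_log_cderive k J v hv); unfold Cminus in r2; lra.
  - unfold X, X', pf_up, pf_down, Cminus; ring. }
pose proof (is_cderive_unique _ _ _ _ d1 d2) as e; fold Z in e.
pose proof total_pf_neq_0 as nz; pose proof INR_n_pos as hn; pose proof INR_k_pos as hkp.
assert (e1 : mag_sum u h = RtoC (INR n) * m h).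
{ unfold m; rewrite Cmult_assoc, <- RtoC_mult, Rinv_r by lra; ring. }
assert (e2 : forall y, mag_sum v y = RtoC (INR k) * m' y).
{ intros; unfold m'; rewrite Cmult_assoc, <- RtoC_mult, Rinv_r by lra; ring. }
rewrite e1, !e2, pf_up_eq, pf_down_eq in e.
assert (hk0 : RtoC (INR k) <> 0) by (intros c; apply RtoC_inj in c; lra).
assert (e3 : RtoC (INR k) * Z * m h = RtoC (INR k) * Z *
  ((1 + m h) / 2 * m' (h + RtoC J) + (1 - m h) / 2 * m' (h - RtoC J))).
{ unfold n in e; rewrite S_INR, RtoC_plus in e.
  transitivity ((RtoC (INR k) + 1) * m h * Z - m h * Z); [ring|rewrite e; field]. }
assert (nz' : RtoC (INR k) * Z <> 0) by (apply Cmult_neq_0; assumption).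
exact (Cmult_cancel_l _ _ _ nz' e3).
Qed.

Lemma mag_n_bounds : (Cmod (m h) <= K)%R /\ (0 <= Re (m h))%R /\
  (Cmod (RtoC (/ INR n) * dmag_sum u h) <= K)%R /\
  is_cderive m h (RtoC (/ INR n) * dmag_sum u h).
Proof.
destruct hu as [hl [hd _]].
destruct (mag_bounds u n h INR_n_pos hl hd) as [b1 [b2 b3]]; [lra|].
split; [exact b1|split; [|split; [exact b2|exact b3]]].
unfold m; rewrite Re_scal; apply Rmult_le_pos.
- left; apply Rinv_0_lt_compat, INR_n_pos.
- apply (Re_mag_sum_ge_0 u a h hd ha hh).
Qed.

(** The complex weights (1 + m)/2 and (1 - m)/2 of [mag_recursion] sum to 1, so the difference is a
    weighted sum of two increments of [m'] over a step J, each at most K J. *)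
Lemma mag_n_close : (Cmod (m h - m' h) <= (1 + K) * (K * J))%R.
Proof.
destruct mag_n_bounds as [bm _]; pose proof mag_bound_pos as hK.
pose proof coupling_pos as hJp; destruct Re_shift as [r1 r2].
assert (s1 : (Cmod (m' (h + J)%C - m' h) <= K * J)%R).
{ replace J with (Cmod J) at 2 by (rewrite Cmod_R; apply Rabs_pos_eq; lra).
  apply m'_lipschitz; lra. }
assert (s2 : (Cmod (m' (h - J)%C - m' h) <= K * J)%R).
{ replace J with (Cmod (- J)) at 2
    by (rewrite Cmod_opp, Cmod_R; apply Rabs_pos_eq; lra).
  apply (m'_lipschitz h (- RtoC J)); unfold Cminus in r2; lra. }
replace (m h - m' h) with ((1 + m h) / 2 * m' (h + RtoC J) + (1 - m h) / 2 * m' (h - RtoC J) - m' h)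
  by (rewrite <- mag_recursion; reflexivity).
replace ((1 + m h) / 2 * m' (h + J) + (1 - m h) / 2 * m' (h - J) - m' h)
  with (/ 2 * ((1 + m h) * (m' (h + J) - m' h)) + / 2 * ((1 - m h) * (m' (h - J) - m' h)))
  by field.
assert (b1 : (Cmod (1 + m h) <= 1 + K)%R)
  by (eapply Rle_trans; [apply Cmod_triangle|rewrite Cmod_1; lra]).
assert (b2 : (Cmod (1 - m h) <= 1 + K)%R)
  by (eapply Rle_trans; [apply Cmod_minus_le|rewrite Cmod_1; lra]).
eapply Rle_trans; [apply Cmod_triangle|].
rewrite <- RtoC_inv, !(Cmod_mult (RtoC (/ 2))), Cmod_R, Rabs_pos_eq, !Cmod_mult by lra.
assert (c1 : (Cmod (1 + m h) * Cmod (m' (h + J)%C - m' h) <= (1 + K) * (K * J))%R)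
  by (apply Rmult_le_compat; try apply Cmod_ge_0; assumption).
assert (c2 : (Cmod (1 - m h) * Cmod (m' (h - J)%C - m' h) <= (1 + K) * (K * J))%R)
  by (apply Rmult_le_compat; try apply Cmod_ge_0; assumption).
lra.
Qed.

(** A definite logarithm of the quotient of the two shifted partition functions, up to the factor
    e^(2h); it can be estimated as an increment of [log_sum v], with no ambiguity modulo 2 pi i. *)
Let D := log_sum v (h + RtoC J) - log_sum v (h - RtoC J).

Lemma pf_up_down : X = X' * Cexp (2 * h + D).
Proof.
pose proof coupling_pos as hJp; destruct Re_shift as [r1 r2].
unfold X, X', pf_up, pf_down.
rewrite <- !(Cexp_log_pf k J v hv) by (unfold Cminus in *; lra).
rewrite <- !Cexp_plus; apply Cexp_eq; unfold D, log_pf; ring.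
Qed.

Lemma log_ratio_close : (Cmod (D - RtoC (2 * beta) * m h) <= J * K2)%R.
Proof.
pose proof coupling_pos as hJp; destruct Re_shift as [r1 r2].
pose proof coupling_k as hJk; pose proof mag_bound_pos as hK; pose proof INR_k_pos as hkp.
destruct hv as [hl [hd _]].
destruct (mag_bounds v k h INR_k_pos hl hd) as [bm' _]; [lra|]; fold (m' h) in bm'.
assert (s1 : (Cmod (D - RtoC (2 * (beta - J)) * m' h) <= 2 * beta * K * J)%R).
(* Subtracting the linear function of slope k m'(h) leaves a derivative of size at most k K J on a
   segment of length 2J, and J k = beta - J. *)
{ pose proof (cderive_increment_le
    (fun s => log_sum v s - RtoC (INR k) * m' h * s)
    (fun s => mag_sum v s - RtoC (INR k) * m' h)
    (h - RtoC J) (RtoC (2 * J)) (INR k * (K * J))) as b.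
  replace (h - J + (2 * J)%R) with (h + RtoC J) in b by (rewrite RtoC_mult; ring).
  replace (D - RtoC (2 * (beta - J)) * m' h) with
    (log_sum v (h + J) - INR k * m' h * (h + J)
     - (log_sum v (h - J) - INR k * m' h * (h - J))).
  2:{ rewrite <- hJk, !RtoC_mult; unfold D; ring. }
  eapply Rle_trans; [apply b|].
  - intros t ht.
    replace (h - J + t * (2 * J)%R) with (h + RtoC ((2 * t - 1) * J))
      by (rewrite !RtoC_mult, RtoC_minus, !RtoC_mult; ring).
    assert (ht' : (Rabs ((2 * t - 1) * J) <= J)%R) by (apply Rabs_le; nra).
    assert (hr : (a / 2 <= Re (h + RtoC ((2 * t - 1) * J)))%R)
      by (rewrite Re_plus; simpl; apply Rabs_le_between in ht'; lra).
    split.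
    + eapply is_cderive_eq.
      * apply is_cderive_minus; [apply log_sum_cderive; [exact hd|lra]|].
        apply is_cderive_mult; [apply is_cderive_const|apply is_cderive_id].
      * cbv beta; ring.
    + replace (mag_sum v (h + ((2 * t - 1) * J)%R) - INR k * m' h) with
        (RtoC (INR k) * (m' (h + RtoC ((2 * t - 1) * J)) - m' h)).
      2:{ rewrite <- (RtoC_scal_inv _ (mag_sum v _) hkp); unfold m'; ring. }
      rewrite Cmod_mult, Cmod_R, Rabs_pos_eq by lra.
      apply Rmult_le_compat_l; [lra|].
      eapply Rle_trans; [apply m'_lipschitz; [lra|exact hr]|].
      rewrite Cmod_R; apply Rmult_le_compat_l; lra.
  - rewrite Cmod_R, Rabs_pos_eq by lra.
    replace (INR k * (K * J) * (2 * J))%R with (2 * (J * INR k) * (K * J))%R by ring.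
    rewrite hJk; assert (0 < K * J)%R by nra; nra. }
(* Two further errors of order J: replacing m' by m, and beta - J by beta. *)
replace (D - RtoC (2 * beta) * m h) with
  ((D - RtoC (2 * (beta - J)) * m' h) + (- RtoC (2 * beta) * (m h - m' h) - RtoC (2 * J) * m' h))
  by (rewrite !RtoC_mult, RtoC_minus; ring).
eapply Rle_trans; [apply Cmod_triangle|].
assert (s2 : (Cmod (- RtoC (2 * beta) * (m h - m' h) - RtoC (2 * J) * m' h)
  <= 2 * beta * ((1 + K) * (K * J)) + 2 * J * K)%R).
{ eapply Rle_trans; [apply Cmod_minus_le|].
  rewrite !Cmod_mult, Cmod_opp, !Cmod_R, !Rabs_pos_eq by lra.
  apply Rplus_le_compat; apply Rmult_le_compat_l; try lra; apply mag_n_close. }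
unfold K2; nra.
Qed.

Lemma log_ratio_bound_pos : (0 < K2)%R.
Proof. pose proof mag_bound_pos; unfold K2; nra. Qed.

Lemma fugacity_field_le :
  (Cmod (fugacity (h + RtoC beta * m h)) <= exp (- (2 * Re h)))%R.
Proof.
destruct mag_n_bounds as [_ [rm _]].
rewrite Cmod_fugacity, Re_plus, Re_scal.
destruct (Rle_lt_or_eq_dec 0 (beta * Re (m h))) as [p|p]; [nra| |].
- left; apply exp_increasing; lra.
- right; f_equal; lra.
Qed.

Lemma exp_a_bounds : (exp (- (2 * Re h)) <= exp (- a))%R /\ (exp (- a) < 1)%R.
Proof.
split; [left; apply exp_increasing; lra|].
rewrite <- exp_0; apply exp_increasing; lra.
Qed.

(** The quotient X / X' is e^(2h + D), which is e^eps / E by definition of eps. Written without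
    division this is 1 - m = E (1 + m) e^(- eps), and the error in the mean-field equation becomes E
    (1 + m)(e^(- eps) - 1)/(1 + E). *)
Lemma mean_field_close : (Cmod (ctanh (h + RtoC beta * m h) - m h) <= J * K3)%R.
Proof.
pose proof fugacity_field_le as hE; destruct exp_a_bounds as [e1 e2].
destruct mag_n_bounds as [bm _]; pose proof log_ratio_bound_pos as hK2; pose proof mag_bound_pos as hK.
pose proof coupling_pos as hJp.
unfold ctanh; set (y := h + RtoC beta * m h) in *; set (E := fugacity y) in *.
set (eps := D - RtoC (2 * beta) * m h).
assert (heps : (Cmod eps <= J * K2)%R) by apply log_ratio_close.
assert (hE1 : (1 - exp (- a) <= Cmod (1 + E))%R).
{ eapply Rle_trans; [|apply Cmod_1_plus]; lra. }
assert (nz : 1 + E <> 0) by (apply Cmod_gt_0; lra).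
assert (r : 1 - m h = E * (1 + m h) * Cexp (- eps)).
{ pose proof pf_up_down as q; rewrite pf_up_eq, pf_down_eq in q.
  apply (Cmult_cancel_l (Z / 2 * Cexp (2 * h + D))).
  { apply Cmult_neq_0; [|apply Cexp_neq_0].
    apply Cmult_neq_0; [exact total_pf_neq_0|].
    intros c; assert (c' : / RtoC 2 * 2 = 0) by (rewrite c; ring).
    rewrite Cinv_l in c' by (intros c2; apply RtoC_inj in c2; lra).
    apply RtoC_inj in c'; lra. }
  transitivity ((1 - m h) / 2 * Z * Cexp (2 * h + D)); [field|].
  rewrite <- q.
  assert (one : Cexp (2 * h + D) * E * Cexp (- eps) = 1).
  { unfold E, fugacity; rewrite <- !Cexp_plus, <- Cexp_0; apply Cexp_eq.
    unfold eps, y; rewrite RtoC_mult; ring. }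
  transitivity ((1 + m h) / 2 * Z * (Cexp (2 * h + D) * E * Cexp (- eps)));
    [rewrite one; ring|field]. }
replace ((1 - E) / (1 + E) - m h) with (E * (1 + m h) * (Cexp (- eps) - 1) / (1 + E)).
2:{ transitivity ((E * (1 + m h) * Cexp (- eps) - E * (1 + m h)) / (1 + E));
      [field; exact nz|].
    rewrite <- r; field; exact nz. }
rewrite Cmod_div, !Cmod_mult by exact nz.
assert (b1 : (Cmod (1 + m h) <= 1 + K)%R)
  by (eapply Rle_trans; [apply Cmod_triangle|rewrite Cmod_1; lra]).
assert (b2 : (Cmod (Cexp (- eps) - 1) <= exp (a * K2) * (J * K2))%R).
{ eapply Rle_trans; [apply Cmod_Cexp_minus_1_le|]; rewrite Cmod_opp.
  apply Rmult_le_compat; [left; apply exp_pos|apply Cmod_ge_0| |exact heps].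
  (* |eps| <= J K2 <= (a/2) K2 < a K2, a bound free of n. *)
  left; apply exp_increasing; nra. }
assert (b3 : (Cmod E * Cmod (1 + m h) <= 1 + K)%R).
{ pose proof (Cmod_ge_0 E); pose proof (Cmod_ge_0 (1 + m h)); nra. }
replace (J * K3)%R with ((1 + K) * (exp (a * K2) * (J * K2)) * / (1 - exp (- a)))%R
  by (unfold K3; field; lra).
apply Rmult_le_compat.
- repeat apply Rmult_le_pos; apply Cmod_ge_0.
- left; apply Rinv_0_lt_compat; lra.
- apply Rmult_le_compat; try apply Cmod_ge_0; try assumption.
  apply Rmult_le_pos; apply Cmod_ge_0.
- apply Rinv_le_contravar; lra.
Qed.

(** The partial derivatives of [free_energy] are tanh(h + beta M) in h and beta (tanh(h + beta M) -
    M) in M, while (log Z_n)/n has derivative m; the difference factors. *)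
Lemma free_energy_gap_cderive :
  is_cderive (fun h => RtoC (/ INR n) * log_pf n J u h - free_energy beta h (m h)) h
    ((1 + RtoC beta * (RtoC (/ INR n) * dmag_sum u h))
      * (m h - ctanh (h + RtoC beta * m h))).
Proof.
destruct mag_n_bounds as [_ [_ [_ dm]]].
pose proof fugacity_field_le as hE; destruct exp_a_bounds as [e1 e2].
set (E := fugacity (h + RtoC beta * m h)) in *.
assert (p : (0 < Re (1 + E))%R) by (pose proof (Re_1_plus E); lra).
assert (nz : 1 + E <> 0) by (apply Cmod_gt_0, Cmod_pos_of_Re, p).
set (dm0 := RtoC (/ INR n) * dmag_sum u h) in *.
eapply is_cderive_eq.
- apply is_cderive_minus.
  + apply is_cderive_mult; [apply is_cderive_const|apply (log_pf_cderive n J u hu); lra].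
  + unfold free_energy; apply is_cderive_minus.
    * apply is_cderive_plus; [apply is_cderive_plus;
        [apply is_cderive_const|apply is_cderive_id]|].
      apply (is_cderive_comp Clog (fun h => 1 + fugacity (h + RtoC beta * m h)));
        [apply is_cderive_Clog, p|].
      apply is_cderive_plus; [apply is_cderive_const|].
      apply (is_cderive_comp fugacity (fun h => h + RtoC beta * m h));
        [apply fugacity_cderive|].
      apply is_cderive_plus; [apply is_cderive_id|].
      apply is_cderive_mult; [apply is_cderive_const|exact dm].
    * apply is_cderive_mult; [apply is_cderive_const|].
      apply is_cderive_mult; (apply is_cderive_minus; [apply is_cderive_const|exact dm]).
- cbv beta; unfold ctanh; fold E; fold (m h).
  change (RtoC (/ INR n) * mag_sum u h) with (m h).
  replace (RtoC beta) with (2 * RtoC (beta / 2)) by (rewrite <- RtoC_mult; f_equal; field).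
  field; exact nz.
Qed.

(** With r = e^(-2 Re h): 2r from [log_sum], 2r from [Clog], and (beta/2)(4r)^2 <= 4 beta r from 1 -
    m; the constant is generous. *)
Lemma free_energy_gap_asymptotics : (exp (- (2 * Re h)) <= 1 / 2)%R ->
  (Cmod (RtoC (/ INR n) * log_pf n J u h - free_energy beta h (m h))
    <= (4 + 8 * beta) * exp (- (2 * Re h)))%R.
Proof.
intros hr; pose proof INR_n_pos as hn; destruct hu as [hl [hd _]].
pose proof fugacity_field_le as hE.
set (E := fugacity (h + RtoC beta * m h)) in *; set (r := exp (- (2 * Re h))) in *.
pose proof (log_sum_asymptotics u (Re h) h hd (Rle_refl _) hr) as b1; fold r in b1.
pose proof (mag_sum_asymptotics u (Re h) h hd ltac:(lra) (Rle_refl _) hr) as b2; fold r in b2.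
rewrite hl in b1, b2.
assert (c1 : (Cmod (RtoC (/ INR n) * log_sum u h - h) <= 2 * r)%R).
{ replace (RtoC (/ INR n) * log_sum u h - h)
    with (RtoC (/ INR n) * (log_sum u h - RtoC (INR n) * h))
    by (transitivity (RtoC (/ INR n) * log_sum u h - RtoC (INR n) * (RtoC (/ INR n) * h));
        [ring|rewrite RtoC_scal_inv by exact hn; reflexivity]).
  rewrite Cmod_mult, Cmod_R, Rabs_pos_eq by (left; apply Rinv_0_lt_compat, hn).
  apply Rmult_le_reg_l with (INR n); [exact hn|].
  rewrite <- Rmult_assoc, Rinv_r, Rmult_1_l by lra; exact b1. }
assert (c2 : (Cmod (1 - m h) <= 4 * r)%R).
{ replace (1 - m h) with (RtoC (/ INR n) * (RtoC (INR n) - mag_sum u h))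
    by (transitivity (RtoC (INR n) * (RtoC (/ INR n) * 1) - RtoC (/ INR n) * mag_sum u h);
        [ring|rewrite RtoC_scal_inv by exact hn; reflexivity]).
  rewrite Cmod_mult, Cmod_R, Rabs_pos_eq by (left; apply Rinv_0_lt_compat, hn).
  apply Rmult_le_reg_l with (INR n); [exact hn|].
  rewrite <- Rmult_assoc, Rinv_r, Rmult_1_l by lra; exact b2. }
assert (c3 : (Cmod (Clog (1 + E)) <= 2 * r)%R).
{ eapply Rle_trans; [apply Cmod_Clog_1_plus_le; lra|lra]. }
assert (hJn : (/ INR n * (J / 2 * INR n ^ 2) = beta / 2)%R) by (unfold J; field; lra).
replace (RtoC (/ INR n) * log_pf n J u h - free_energy beta h (m h)) with
  ((RtoC (/ INR n) * log_sum u h - h) - Clog (1 + E)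
    + RtoC (beta / 2) * ((1 - m h) * (1 - m h))).
2:{ unfold free_energy, log_pf; fold E; rewrite <- hJn, RtoC_mult; ring. }
assert (r0 : (0 < r)%R) by apply exp_pos.
eapply Rle_trans; [apply Cmod_triangle|].
rewrite !Cmod_mult, Cmod_R, Rabs_pos_eq by lra.
assert (c4 : (Cmod (1 - m h) * Cmod (1 - m h) <= 16 * r * (1 / 2))%R).
{ pose proof (Cmod_ge_0 (1 - m h)); nra. }
pose proof (Cmod_minus_le (RtoC (/ INR n) * log_sum u h - h) (Clog (1 + E))).
nra.
Qed.

End Point.
(** Integration to infinity is replaced by a step from h to h + T: the path costs T times O(1/n),
    the far endpoint is covered by the asymptotics. For the limit, T is chosen before n. *)
Lemma free_energy_close (h : C) (T : R) : (a <= Re h)%R -> (0 < T)%R ->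
  (exp (- (2 * (a + T))) <= 1 / 2)%R ->
  (Cmod (RtoC (/ INR n) * log_pf n J u h - free_energy beta h (m h))
    <= T * (J * ((1 + beta * K) * K3)) + (4 + 8 * beta) * exp (- (2 * (a + T))))%R.
Proof.
intros hh hT he; set (g := fun h => RtoC (/ INR n) * log_pf n J u h - free_energy beta h (m h)).
assert (re : forall t : R, Re (h + RtoC t) = (Re h + t)%R) by (intros; reflexivity).
pose proof mag_bound_pos as hK.
assert (b : (Cmod (g (h + RtoC T)%C - g h) <= J * ((1 + beta * K) * K3) * Cmod (RtoC T))%R).
{ apply (cderive_increment_le g
    (fun h => (1 + RtoC beta * (RtoC (/ INR n) * dmag_sum u h))
      * (m h - ctanh (h + RtoC beta * m h)))).
  intros t ht; rewrite <- RtoC_mult.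
  assert (hr : (a <= Re (h + RtoC (t * T)))%R) by (rewrite re; nra).
  split; [apply free_energy_gap_cderive, hr|].
  destruct (mag_n_bounds _ hr) as [_ [_ [bd _]]].
  pose proof (mean_field_close _ hr) as bt; rewrite Cmod_minus_sym in bt.
  rewrite Cmod_mult; replace (J * ((1 + beta * K) * K3))%R
    with ((1 + beta * K) * (J * K3))%R by ring.
  apply Rmult_le_compat; try apply Cmod_ge_0; [|exact bt].
  eapply Rle_trans; [apply Cmod_triangle|]; rewrite Cmod_1, Cmod_mult, Cmod_R, Rabs_pos_eq by lra.
  apply Rplus_le_compat_l, Rmult_le_compat_l; [lra|exact bd]. }
assert (ee : (exp (- (2 * Re (h + RtoC T))) <= exp (- (2 * (a + T))))%R).
{ rewrite re; destruct hh as [hh|<-]; [left; apply exp_increasing; lra|right; reflexivity]. }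
assert (c : (Cmod (g (h + RtoC T)%C) <= (4 + 8 * beta) * exp (- (2 * (a + T))))%R).
{ eapply Rle_trans; [apply free_energy_gap_asymptotics; [rewrite re; lra|lra]|].
  apply Rmult_le_compat_l; lra. }
change (Cmod (g h) <= T * (J * ((1 + beta * K) * K3)) + (4 + 8 * beta) * exp (- (2 * (a + T))))%R.
replace (g h) with (g (h + RtoC T) - (g (h + RtoC T) - g h)) by ring.
eapply Rle_trans; [apply Cmod_minus_le|].
rewrite Cmod_R, Rabs_pos_eq in b by lra; lra.
Qed.

End FiniteSize.

(** Collects the estimates with constants depending on beta and a alone; the system of n - 1 spins
    no longer appears. The single [L] dominates both error constants. *)
Lemma finite_size (beta a : R) : (0 < beta)%R -> (0 < a)%R ->
  exists K L, (0 < L)%R /\ forall n u, (2 <= n)%nat -> (beta / INR n <= a / 2)%R ->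
  lee_yang_data n (beta / INR n) u -> forall h, (a <= Re h)%R ->
  let M := RtoC (/ INR n) * mag_sum u h in
  (0 <= Re M)%R /\ (Cmod M <= K)%R /\
  (Cmod (ctanh (h + RtoC beta * M) - M) <= beta / INR n * L)%R /\
  forall T, (0 < T)%R -> (exp (- (2 * (a + T))) <= 1 / 2)%R ->
  (Cmod (RtoC (/ INR n) * log_pf n (beta / INR n) u h - free_energy beta h M)
    <= T * (beta / INR n * L) + (4 + 8 * beta) * exp (- (2 * (a + T))))%R.
Proof.
intros hb ha.
pose proof (mag_bound_pos a ha) as hK; pose proof (log_ratio_bound_pos beta a hb ha) as hK2.
set (K := (4 / (1 - exp (- a)) ^ 2)%R) in *.
set (K2 := (2 * beta * K + 2 * beta * ((1 + K) * K) + 2 * K)%R) in *.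
set (K3 := ((1 + K) * (exp (a * K2) * K2) / (1 - exp (- a)))%R).
assert (hK3 : (0 < K3)%R).
{ pose proof (exp_increasing (- a) 0) as e; rewrite exp_0 in e.
  apply Rdiv_lt_0_compat; [|lra].
  repeat apply Rmult_lt_0_compat; try lra; apply exp_pos. }
assert (hL : (K3 <= (1 + beta * K) * K3)%R) by (assert (0 < beta * K)%R by nra; nra).
exists K, ((1 + beta * K) * K3)%R; split; [lra|].
intros n u hn hJ hu h hh M; destruct n as [|k]; [lia|].
assert (hk : (1 <= k)%nat) by lia.
assert (hJp : (0 < beta / INR (S k))%R)
  by (apply Rdiv_lt_0_compat; [exact hb|apply lt_0_INR; lia]).
destruct (lee_yang k (beta / INR (S k)) hJp) as [v hv].
destruct (mag_n_bounds beta a k u ha hk hu h hh) as [b1 [b2 _]].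
split; [exact b2|split; [exact b1|split]].
- eapply Rle_trans; [apply (mean_field_close beta a k u v hb ha hk hJ hu hv h hh)|].
  apply Rmult_le_compat_l; [lra|exact hL].
- intros T hT he.
  apply (free_energy_close beta a k u v hb ha hk hJ hu hv h T hh hT he).
Qed.

(** Expressed through spin sums so that it is a sequence in n without a choice of Lee-Yang lists. *)
Definition mean_mag (n : nat) (J : R) (h : C) : C :=
  RtoC (/ INR n) * (spin_sum n (fun s => RtoC s * weight J h s) / spin_pf n J h).

Lemma mean_mag_eq (n : nat) (J : R) (u : list C) (h : C) :
  lee_yang_data n J u -> (0 < Re h)%R ->
  mean_mag n J h = RtoC (/ INR n) * mag_sum u h.
Proof.
intros hu hh; unfold mean_mag; f_equal.
rewrite <- (is_cderive_unique _ _ _ _ (spin_pf_log_cderive n J u hu h hh)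
  (spin_pf_cderive n J h)).
field; apply (spin_pf_neq_0 n J u hu h hh).
Qed.

(** * The Schwarz-Pick inequality for the hyperbolic tangent *)

Lemma sinh_mvt (a b : R) : (a <= b)%R ->
  exists c, (a <= c <= b)%R /\ (sinh b - sinh a = cosh c * (b - a))%R.
Proof.
intros hab; destruct (MVT_gen sinh a b cosh) as [c [hc e]].
- intros x _; apply is_derive_Reals, derivable_pt_lim_sinh.
- intros x _; apply derivable_continuous_pt, derivable_pt_sinh.
- rewrite Rmin_left, Rmax_right in hc by lra; exists c; split; assumption.
Qed.

Lemma cosh_le (x y : R) : (0 <= x <= y)%R -> (cosh x <= cosh y)%R.
Proof.
intros [hx hxy]; unfold cosh; rewrite !exp_Ropp.
assert (h1 : (1 <= exp x)%R).
{ rewrite <- exp_0; destruct hx as [hx|<-]; [left; apply exp_increasing, hx|lra]. }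
assert (h2 : (exp x <= exp y)%R).
{ destruct hxy as [hl|<-]; [left; apply exp_increasing, hl|lra]. }
set (p := exp x) in *; set (q := exp y) in *.
assert (e : (q + / q - (p + / p) = (q - p) * (p * q - 1) / (p * q))%R) by (field; lra).
assert (0 <= (q - p) * (p * q - 1) / (p * q))%R; [|lra].
apply Rmult_le_pos; [apply Rmult_le_pos; nra|left; apply Rinv_0_lt_compat; nra].
Qed.

Lemma sinh_ge (x : R) : (0 <= x)%R -> (x <= sinh x)%R.
Proof.
intros hx; destruct (sinh_mvt 0 x hx) as [c [hc e]].
rewrite sinh_0 in e; pose proof (cosh_le 0 c) as l; rewrite cosh_0 in l; nra.
Qed.

(** Monotonicity of sinh(x)/x, from two mean values of cosh, in a form that includes q = 0. *)
Lemma sinh_ratio_le (q p : R) : (0 <= q <= p)%R -> (p * sinh q <= q * sinh p)%R.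
Proof.
intros [h0 h1]; destruct (sinh_mvt 0 q h0) as [c [hc e]].
destruct (sinh_mvt q p h1) as [d [hd e']]; rewrite sinh_0 in e.
pose proof (cosh_le c d ltac:(lra)).
assert (e1 : sinh q = (cosh c * q)%R) by lra.
assert (q * (p - q) * cosh c <= q * (p - q) * cosh d)%R
  by (apply Rmult_le_compat_l; [nra|assumption]).
assert (q * (sinh p - sinh q) = q * (p - q) * cosh d)%R by (rewrite e'; ring).
nra.
Qed.

Lemma sin_sqr_le (x : R) : (sin x ^ 2 <= x ^ 2)%R.
Proof.
assert (pos : forall y, (0 <= y)%R -> (sin y ^ 2 <= y ^ 2)%R).
{ intros y [hy|<-]; [|rewrite sin_0; lra].
  pose proof (sin_lt_x y hy); pose proof (SIN_bound y).
  destruct (Rle_or_lt 1 y) as [h1|h1]; [nra|].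
  pose proof PI2_1; assert (0 <= sin y)%R by (apply sin_ge_0; unfold PI in *; lra).
  nra. }
destruct (Rle_or_lt 0 x) as [h|h]; [apply pos, h|].
replace (sin x ^ 2)%R with (sin (- x) ^ 2)%R by (rewrite sin_neg; ring).
replace (x ^ 2)%R with ((- x) ^ 2)%R by ring; apply pos; lra.
Qed.

(** The Schwarz-Pick inequality for e^(-2y) in real coordinates: q and p are the difference and sum
    of the real parts, d the difference of the imaginary parts. It combines q^2 sin^2 d <= d^2
    sinh^2 q with p sinh q <= q sinh p. *)
Lemma schwarz_pick_real (q p d : R) : (0 <= q < p)%R ->
  ((sinh q ^ 2 + sin d ^ 2) * (p ^ 2 - q ^ 2)
    <= (q ^ 2 + d ^ 2) * (sinh p ^ 2 - sinh q ^ 2))%R.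
Proof.
intros [h0 h1].
pose proof (sinh_ge q h0) as gq; pose proof (sinh_ge p ltac:(lra)) as gp.
pose proof (sinh_ratio_le q p ltac:(lra)) as rt; pose proof (sin_sqr_le d) as sd.
set (sq := sinh q) in *; set (sp := sinh p) in *; set (s2 := (sin d ^ 2)%R) in *.
assert (hp2 : (p ^ 2 <= sp ^ 2)%R) by nra.
assert (hq2 : (q ^ 2 <= sq ^ 2)%R) by nra.
assert (hr2 : ((p * sq) ^ 2 <= (q * sp) ^ 2)%R).
{ apply pow_incr; split; [apply Rmult_le_pos; lra|exact rt]. }
assert (hd : (0 <= d ^ 2)%R) by nra.
(* For q > 0 the inequality is multiplied by q^2; for q = 0 that would lose it, and it reduces to
   p^2 sin^2 d <= d^2 sinh^2 p. *)
destruct h0 as [h0| <-].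
- apply Rmult_le_reg_l with (q ^ 2)%R; [nra|].
  assert (hpq : (0 <= p ^ 2 - q ^ 2)%R) by nra.
  assert (A1 : (q ^ 2 * s2 <= sq ^ 2 * d ^ 2)%R).
  { assert (0 <= s2)%R by (unfold s2; nra).
    apply Rmult_le_compat; nra. }
  assert (A2 : ((q ^ 2 + d ^ 2) * (sq ^ 2 * (p ^ 2 - q ^ 2))
    <= (q ^ 2 + d ^ 2) * (q ^ 2 * (sp ^ 2 - sq ^ 2)))%R).
  { apply Rmult_le_compat_l; nra. }
  assert (A3 : ((q ^ 2 * sq ^ 2 + q ^ 2 * s2) * (p ^ 2 - q ^ 2)
    <= (q ^ 2 * sq ^ 2 + sq ^ 2 * d ^ 2) * (p ^ 2 - q ^ 2))%R).
  { apply Rmult_le_compat_r; lra. }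
  nra.
- assert (sq0 : sq = 0%R) by apply sinh_0.
  rewrite sq0.
  assert (s2 * p ^ 2 <= d ^ 2 * sp ^ 2)%R.
  { assert (0 <= s2)%R by (unfold s2; nra). apply Rmult_le_compat; nra. }
  nra.
Qed.

(** e^(-2 y1) - e^(-2 y2) = -2 e^(-(y1 + y2)) sinh(y1 - y2), and |sinh(a + ib)|^2 = sinh^2 a + sin^2
    b. *)
Lemma fugacity_dist (y1 y2 : C) :
  (Cmod (fugacity y1 - fugacity y2) ^ 2
    = 4 * exp (- (2 * (Re y1 + Re y2)))
      * (sinh (Re y1 - Re y2) ^ 2 + sin (Im y1 - Im y2) ^ 2))%R.
Proof.
rewrite Cmod2_alt; unfold fugacity, Cexp.
replace (Re (- (2 * y1))) with (- (2 * Re y1))%R by (destruct y1; simpl; ring).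
replace (Re (- (2 * y2))) with (- (2 * Re y2))%R by (destruct y2; simpl; ring).
replace (Im (- (2 * y1))) with (- (2 * Im y1))%R by (destruct y1; simpl; ring).
replace (Im (- (2 * y2))) with (- (2 * Im y2))%R by (destruct y2; simpl; ring).
set (a1 := Re y1); set (a2 := Re y2); set (b1 := Im y1); set (b2 := Im y2).
unfold Re, Im; simpl fst; simpl snd.
set (e1 := exp (- (2 * a1))); set (e2 := exp (- (2 * a2))).
assert (hs : (4 * exp (- (2 * (a1 + a2))) * sinh (a1 - a2) ^ 2 = (e1 - e2) ^ 2)%R).
{ assert (h : (2 * exp (- (a1 + a2)) * sinh (a1 - a2) = e2 - e1)%R).
  { unfold sinh, e1, e2.
    transitivity (exp (- (a1 + a2)) * exp (a1 - a2)
      - exp (- (a1 + a2)) * exp (- (a1 - a2)))%R; [field|].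
    rewrite <- !exp_plus; f_equal; [|f_equal]; f_equal; ring. }
  replace (exp (- (2 * (a1 + a2)))) with (exp (- (a1 + a2)) * exp (- (a1 + a2)))%R
    by (rewrite <- exp_plus; f_equal; ring).
  transitivity ((2 * exp (- (a1 + a2)) * sinh (a1 - a2)) ^ 2)%R; [ring|rewrite h; ring]. }
assert (he : exp (- (2 * (a1 + a2))) = (e1 * e2)%R)
  by (unfold e1, e2; rewrite <- exp_plus; f_equal; ring).
assert (hc : (2 * sin (b1 - b2) ^ 2 = 1 - (cos (- (2 * b1)) * cos (- (2 * b2)) + sin (- (2 * b1)) * sin (- (2 * b2))))%R).
{ rewrite <- cos_minus.
  replace (- (2 * b1) - - (2 * b2))%R with (2 * (b2 - b1))%R by ring.
  rewrite cos_2a_sin; replace (b2 - b1)%R with (- (b1 - b2))%R by ring.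
  rewrite sin_neg; ring. }
rewrite Rmult_plus_distr_l, hs, he.
transitivity (e1 ^ 2 * 1 + e2 ^ 2 * 1 - 2 * e1 * e2 * (1 - 2 * sin (b1 - b2) ^ 2))%R; [|ring].
rewrite hc.
pose proof (sin2_cos2 (- (2 * b1))) as t1; pose proof (sin2_cos2 (- (2 * b2))) as t2.
unfold Rsqr in t1, t2; rewrite <- t1 at 1; rewrite <- t2 at 1; ring.
Qed.

Lemma fugacity_schwarz_pick (y1 y2 : C) : (0 < Re y1)%R -> (0 < Re y2)%R ->
  (4 * Cmod (fugacity y1 - fugacity y2) ^ 2 * (Re y1 * Re y2) <=
   Cmod (y1 - y2) ^ 2
   * ((1 - Cmod (fugacity y1) ^ 2) * (1 - Cmod (fugacity y2) ^ 2)))%R.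
Proof.
intros h1 h2; rewrite fugacity_dist, !Cmod_fugacity, (Cmod2_alt (y1 - y2)).
replace (Re (y1 - y2)) with (Re y1 - Re y2)%R by (destruct y1, y2; reflexivity).
replace (Im (y1 - y2)) with (Im y1 - Im y2)%R by (destruct y1, y2; reflexivity).
set (a1 := Re y1) in *; set (a2 := Re y2) in *; set (d := (Im y1 - Im y2)%R).
(* sinh^2(a1 + a2) - sinh^2(a1 - a2) = sinh(2 a1) sinh(2 a2); likewise 4 a1 a2 is the difference of
   the squares of a1 + a2 and a1 - a2. *)
assert (hp : ((1 - exp (- (2 * a1)) ^ 2) * (1 - exp (- (2 * a2)) ^ 2)
  = 4 * exp (- (2 * (a1 + a2))) * (sinh (a1 + a2) ^ 2 - sinh (a1 - a2) ^ 2))%R).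
{ unfold sinh.
  set (u := exp (- a1)); set (v := exp (- a2)).
  assert (hu : (0 < u)%R) by apply exp_pos; assert (hv : (0 < v)%R) by apply exp_pos.
  replace (exp (- (2 * a1))) with (u * u)%R by (unfold u; rewrite <- exp_plus; f_equal; ring).
  replace (exp (- (2 * a2))) with (v * v)%R by (unfold v; rewrite <- exp_plus; f_equal; ring).
  replace (exp (- (2 * (a1 + a2)))) with (u * u * (v * v))%R
    by (unfold u, v; rewrite <- !exp_plus; f_equal; ring).
  replace (exp (- (a1 + a2))) with (u * v)%R by (unfold u, v; rewrite <- !exp_plus; f_equal; ring).
  replace (exp (a1 + a2)) with (/ u * / v)%R
    by (unfold u, v; rewrite <- !exp_Ropp, <- exp_plus; f_equal; ring).
  replace (exp (a1 - a2)) with (/ u * v)%R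
    by (unfold u, v; rewrite <- !exp_Ropp, <- exp_plus; f_equal; ring).
  replace (exp (- (a1 - a2))) with (u * / v)%R
    by (unfold u, v; rewrite <- !exp_Ropp, <- exp_plus; f_equal; ring).
  field; lra. }
rewrite hp.
assert (key : ((sinh (a1 - a2) ^ 2 + sin d ^ 2) * ((a1 + a2) ^ 2 - (a1 - a2) ^ 2)
  <= ((a1 - a2) ^ 2 + d ^ 2) * (sinh (a1 + a2) ^ 2 - sinh (a1 - a2) ^ 2))%R).
{ destruct (Rle_or_lt 0 (a1 - a2)) as [c|c]; [apply schwarz_pick_real; lra|].
  pose proof (schwarz_pick_real (a2 - a1) (a1 + a2) d ltac:(lra)) as k.
  assert (es : sinh (a2 - a1) = (- sinh (a1 - a2))%R)
    by (unfold sinh; replace (- (a2 - a1))%R with (a1 - a2)%R by ring;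
        replace (- (a1 - a2))%R with (a2 - a1)%R by ring; field).
  rewrite es in k.
  replace ((- sinh (a1 - a2)) ^ 2)%R with (sinh (a1 - a2) ^ 2)%R in k by ring.
  replace ((a2 - a1) ^ 2)%R with ((a1 - a2) ^ 2)%R in k by ring; exact k. }
pose proof (exp_pos (- (2 * (a1 + a2)))) as ep.
set (e := exp (- (2 * (a1 + a2)))) in *.
apply Rle_trans with (4 * e * ((sinh (a1 - a2) ^ 2 + sin d ^ 2) * ((a1 + a2) ^ 2 - (a1 - a2) ^ 2)))%R;
  [right; ring|].
apply Rle_trans with (4 * e * (((a1 - a2) ^ 2 + d ^ 2) * (sinh (a1 + a2) ^ 2 - sinh (a1 - a2) ^ 2)))%R;
  [|right; ring].
apply Rmult_le_compat_l; [lra|exact key].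
Qed.

Lemma fugacity_lt_1 (y : C) : (0 < Re y)%R -> (Cmod (fugacity y) < 1)%R.
Proof. intros hy; rewrite Cmod_fugacity; apply exp_neg_lt_1, hy. Qed.

Lemma one_plus_fugacity_neq_0 (y : C) : (0 < Re y)%R -> 1 + fugacity y <> 0.
Proof.
intros hy; pose proof (fugacity_lt_1 y hy); pose proof (Cmod_1_plus (fugacity y)).
apply Cmod_gt_0; lra.
Qed.

Lemma Re_ctanh (y : C) : (0 < Re y)%R ->
  (Re (ctanh y) = (1 - Cmod (fugacity y) ^ 2) / Cmod (1 + fugacity y) ^ 2)%R.
Proof.
intros hy; pose proof (one_plus_fugacity_neq_0 y hy) as nz.
unfold ctanh; set (E := fugacity y) in *.
assert (e : (1 - E) / (1 + E) = RtoC (/ (Cmod (1 + E) ^ 2)) * ((1 - E) * Cconj (1 + E))).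
{ assert (hm : Cmod (1 + E) <> 0%R) by (apply Rgt_not_eq, Cmod_gt_0, nz).
  rewrite RtoC_inv, Cmod2_conj by (apply pow_nonzero; exact hm).
  field; split; [|exact nz].
  intros c; apply nz; rewrite <- (Cconj_conj (1 + E)), c; apply Ceq; simpl; ring. }
rewrite e, Re_scal, Rmult_comm; unfold Rdiv; f_equal.
rewrite Cmod2_alt; unfold Re, Im; destruct E; simpl; ring.
Qed.

Lemma Re_ctanh_ge_0 (y : C) : (0 < Re y)%R -> (0 <= Re (ctanh y))%R.
Proof.
intros hy; rewrite Re_ctanh by exact hy; pose proof (fugacity_lt_1 y hy).
pose proof (Cmod_ge_0 (fugacity y)).
apply Rmult_le_pos; [nra|].
left; apply Rinv_0_lt_compat, pow_lt, Cmod_gt_0, one_plus_fugacity_neq_0, hy.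
Qed.

(** The map E -> (1 - E)/(1 + E) is an isometry from the hyperbolic disc to the half-plane, so the
    inequality for the fugacity carries over. *)
Lemma ctanh_schwarz_pick (y1 y2 : C) : (0 < Re y1)%R -> (0 < Re y2)%R ->
  (Cmod (ctanh y1 - ctanh y2) ^ 2 * (Re y1 * Re y2) <=
   Cmod (y1 - y2) ^ 2 * (Re (ctanh y1) * Re (ctanh y2)))%R.
Proof.
intros h1 h2; rewrite !Re_ctanh by assumption.
pose proof (fugacity_schwarz_pick y1 y2 h1 h2) as k.
pose proof (one_plus_fugacity_neq_0 y1 h1) as n1.
pose proof (one_plus_fugacity_neq_0 y2 h2) as n2.
unfold ctanh; set (E1 := fugacity y1) in *; set (E2 := fugacity y2) in *.
replace ((1 - E1) / (1 + E1) - (1 - E2) / (1 + E2))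
  with (-2 * (E1 - E2) / ((1 + E1) * (1 + E2))) by (field; auto).
rewrite Cmod_div, !Cmod_mult, Cmod_R, Rabs_left by (lra || apply Cmult_neq_0; assumption).
apply Cmod_gt_0 in n1; apply Cmod_gt_0 in n2.
set (c1 := Cmod (1 + E1)) in *; set (c2 := Cmod (1 + E2)) in *.
apply Rmult_le_reg_r with ((c1 * c2) ^ 2)%R; [apply pow_lt; nra|].
match goal with |- (?l * _ <= ?r * _)%R =>
  apply Rle_trans with (4 * Cmod (E1 - E2) ^ 2 * (Re y1 * Re y2))%R;
  [right; field; lra|eapply Rle_trans; [exact k|right; field; lra]] end.
Qed.

(** With y = h + beta M and T = tanh y, an approximate solution satisfies beta Re T <= (1 - lam) Re
    y. Inserted in Schwarz-Pick for both points, this yields |T1 - T2| <= (1 - lam) |M1 - M2|; the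
    triangle inequality concludes. *)
Lemma mean_field_stable (beta K : R) (h M1 M2 : C) : (0 < beta)%R -> (0 < Re h)%R ->
  (0 <= Re M1)%R -> (0 <= Re M2)%R -> (Cmod M1 <= K)%R -> (Cmod M2 <= K)%R ->
  let d1 := Cmod (ctanh (h + RtoC beta * M1) - M1) in
  let d2 := Cmod (ctanh (h + RtoC beta * M2) - M2) in
  (beta * d1 <= Re h / 2)%R -> (beta * d2 <= Re h / 2)%R ->
  (Re h / (2 * (Re h + beta * K)) * Cmod (M1 - M2) <= d1 + d2)%R.
Proof.
intros hb hh r1 r2 b1 b2 d1 d2 h1 h2.
set (y1 := h + RtoC beta * M1) in *; set (y2 := h + RtoC beta * M2) in *.
assert (hK : (0 <= K)%R) by (pose proof (Cmod_ge_0 M1); lra).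
assert (e1 : Re y1 = (Re h + beta * Re M1)%R) by (unfold y1; rewrite Re_plus, Re_scal; reflexivity).
assert (e2 : Re y2 = (Re h + beta * Re M2)%R) by (unfold y2; rewrite Re_plus, Re_scal; reflexivity).
assert (p1 : (0 < Re y1)%R) by nra; assert (p2 : (0 < Re y2)%R) by nra.
pose proof (ctanh_schwarz_pick y1 y2 p1 p2) as sp.
pose proof (Re_ctanh_ge_0 y1 p1) as t1; pose proof (Re_ctanh_ge_0 y2 p2) as t2.
set (T1 := ctanh y1) in *; set (T2 := ctanh y2) in *.
(* Half of the gap Re h is given up to the defect beta d <= Re h / 2; the other half is at least lam
   Re y, since Re y <= Re h + beta K. *)
set (lam := (Re h / (2 * (Re h + beta * K)))%R).
assert (hpos : (0 < Re h + beta * K)%R) by nra.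
assert (hlam : (0 < lam)%R) by (apply Rdiv_lt_0_compat; lra).
assert (hlam1 : (lam * (Re h + beta * K) = Re h / 2)%R) by (unfold lam; field; lra).
assert (aux : forall M : C, (Cmod M <= K)%R -> (0 <= Re M)%R ->
  forall T, (beta * Cmod (T - M) <= Re h / 2)%R ->
  (beta * Re T <= (1 - lam) * (Re h + beta * Re M))%R).
{ intros M bM rM T hT.
  assert (i1 : (Re T - Re M <= Cmod (T - M))%R).
  { eapply Rle_trans; [|apply re_le_Cmod]; eapply Rle_trans; [|apply Rle_abs].
    right; destruct T, M; reflexivity. }
  assert (i2 : (Re M <= K)%R).
  { eapply Rle_trans; [apply Rle_abs|]; eapply Rle_trans; [apply re_le_Cmod|exact bM]. }
  assert (i3 : (lam * (Re h + beta * Re M) <= Re h / 2)%R).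
  { rewrite <- hlam1; apply Rmult_le_compat_l; [lra|]; nra. }
  nra. }
pose proof (aux M1 b1 r1 T1 h1) as u1; pose proof (aux M2 b2 r2 T2 h2) as u2.
rewrite <- e1 in u1; rewrite <- e2 in u2.
assert (hl1 : (lam <= 1)%R).
{ assert (0 <= (1 - lam) * Re y1)%R by nra; nra. }
replace (y1 - y2) with (RtoC beta * (M1 - M2)) in sp by (unfold y1, y2; ring).
rewrite Cmod_mult, Cmod_R, Rabs_pos_eq in sp by lra.
assert (contr : (Cmod (T1 - T2) <= (1 - lam) * Cmod (M1 - M2))%R).
{
  pose proof (Cmod_ge_0 (T1 - T2)); pose proof (Cmod_ge_0 (M1 - M2)) as m0.
  apply Rsqr_incr_0_var; [|apply Rmult_le_pos; lra].
  unfold Rsqr; apply Rmult_le_reg_r with (Re y1 * Re y2)%R; [nra|].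
  assert (w : (beta * Re T1 * (beta * Re T2) <= ((1 - lam) * Re y1) * ((1 - lam) * Re y2))%R)
    by (apply Rmult_le_compat; try assumption; apply Rmult_le_pos; lra).
  assert (w2 : (Cmod (M1 - M2) ^ 2 * (beta * Re T1 * (beta * Re T2))
    <= Cmod (M1 - M2) ^ 2 * (((1 - lam) * Re y1) * ((1 - lam) * Re y2)))%R)
    by (apply Rmult_le_compat_l; [nra|exact w]).
  nra. }
assert (tri : (Cmod (M1 - M2) <= Cmod (T1 - T2) + d1 + d2)%R).
{ replace (M1 - M2) with ((T1 - T2) - (T1 - M1) + (T2 - M2)) by ring.
  eapply Rle_trans; [apply Cmod_triangle|].
  pose proof (Cmod_minus_le (T1 - T2) (T1 - M1)); unfold d1, d2; lra. }
lra.
Qed.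

(** * The thermodynamic limit *)

Lemma Cmod_Cauchy_complete (x : nat -> C) :
  (forall eps, (0 < eps)%R -> exists N, forall n p, (N <= n)%nat -> (N <= p)%nat ->
    (Cmod (x n - x p) < eps)%R) ->
  exists l, forall eps, (0 < eps)%R -> exists N, forall n, (N <= n)%nat ->
    (Cmod (x n - l) < eps)%R.
Proof.
intros hx.
assert (cr : Cauchy_crit (fun n => Re (x n))).
{ intros eps he; destruct (hx eps he) as [N hN]; exists N; intros n p hn hp.
  eapply Rle_lt_trans; [|apply (hN n p hn hp)].
  unfold Rdist; change (Re (x n) - Re (x p))%R with (Re (x n - x p)); apply re_le_Cmod. }
assert (ci : Cauchy_crit (fun n => Im (x n))).
{ intros eps he; destruct (hx eps he) as [N hN]; exists N; intros n p hn hp.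
  eapply Rle_lt_trans; [|apply (hN n p hn hp)].
  unfold Rdist; change (Im (x n) - Im (x p))%R with (Im (x n - x p)); apply Im_le_Cmod. }
destruct (Rcomplete.R_complete _ cr) as [lr hr]; destruct (Rcomplete.R_complete _ ci) as [li hi].
exists (lr, li); intros eps he.
destruct (hr (eps / 2)%R) as [N1 h1]; [lra|]; destruct (hi (eps / 2)%R) as [N2 h2]; [lra|].
exists (max N1 N2); intros n hn.
specialize (h1 n ltac:(lia)); specialize (h2 n ltac:(lia)).
eapply Rle_lt_trans; [apply Cmod_le_Re_Im|].
change (Rabs (Re (x n) - lr) + Rabs (Im (x n) - li) < eps)%R.
unfold Rdist in *; lra.
Qed.

Lemma cderive_continuous (f : C -> C) (z l : C) : is_cderive f z l ->
  forall eps, (0 < eps)%R -> exists delta, (0 < delta)%R /\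
  forall y, (Cmod (y - z) < delta)%R -> (Cmod (f y - f z) < eps)%R.
Proof.
intros hf eps he; rewrite is_cderive_eps in hf.
destruct (hf 1%R Rlt_0_1) as [d [hd H]].
assert (hl : (0 < Cmod l + 1)%R) by (pose proof (Cmod_ge_0 l); lra).
exists (Rmin d (eps / (Cmod l + 1))); split.
{ apply Rmin_pos; [exact hd|apply Rdiv_lt_0_compat; lra]. }
intros y hy.
assert (h1 : (Cmod (y - z) < d)%R) by (eapply Rlt_le_trans; [exact hy|apply Rmin_l]).
assert (h2 : (Cmod (y - z) * (Cmod l + 1) < eps)%R).
{ apply Rlt_le_trans with (eps / (Cmod l + 1) * (Cmod l + 1))%R; [|right; field; lra].
  apply Rmult_lt_compat_r; [exact hl|]; eapply Rlt_le_trans; [exact hy|apply Rmin_r]. }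
specialize (H _ h1); replace (z + (y - z)) with y in H by ring.
replace (f y - f z) with ((f y - f z - (y - z) * l) + (y - z) * l) by ring.
eapply Rle_lt_trans; [apply Cmod_triangle|]; rewrite Cmod_mult; lra.
Qed.

Lemma ctanh_cderive (y : C) : (0 < Re y)%R -> exists l, is_cderive ctanh y l.
Proof.
intros hy; pose proof (one_plus_fugacity_neq_0 y hy) as nz; eexists.
apply is_cderive_mult.
- apply is_cderive_minus; [apply is_cderive_const|apply fugacity_cderive].
- apply (is_cderive_comp Cinv (fun y => 1 + fugacity y)); [apply is_cderive_Cinv, nz|].
  apply is_cderive_plus; [apply is_cderive_const|apply fugacity_cderive].
Qed.

Lemma field_cderive (beta : R) (h M : C) : is_cderive (fun M => h + RtoC beta * M) M beta.
Proof.
eapply is_cderive_eq.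
- apply is_cderive_plus; [apply is_cderive_const|].
  apply is_cderive_mult; [apply is_cderive_const|apply is_cderive_id].
- cbv beta; ring.
Qed.

Lemma free_energy_cderive (beta : R) (h M : C) : (0 < Re (h + RtoC beta * M))%R ->
  exists l, is_cderive (free_energy beta h) M l.
Proof.
intros hy; eexists; unfold free_energy.
apply is_cderive_minus.
- apply is_cderive_plus; [apply is_cderive_const|].
  apply (is_cderive_comp Clog (fun M => 1 + fugacity (h + RtoC beta * M))).
  + apply is_cderive_Clog; pose proof (fugacity_lt_1 _ hy).
    pose proof (Re_1_plus (fugacity (h + beta * M))); lra.
  + apply is_cderive_plus; [apply is_cderive_const|].
    apply (is_cderive_comp fugacity (fun M => h + RtoC beta * M));
      [apply fugacity_cderive|apply field_cderive].
- apply is_cderive_mult; [apply is_cderive_const|].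
  apply is_cderive_mult; (apply is_cderive_minus; [apply is_cderive_const|apply is_cderive_id]).
Qed.

(** Stability makes a sequence of approximate solutions Cauchy, so the exact solution is obtained as
    its limit and its existence needs no separate argument. *)
Lemma mean_field_limit (beta K : R) (h : C) (x : nat -> C) : (0 < beta)%R -> (0 < Re h)%R ->
  (exists N, forall n, (N <= n)%nat -> (0 <= Re (x n))%R /\ (Cmod (x n) <= K)%R) ->
  (forall eps, (0 < eps)%R -> exists N, forall n, (N <= n)%nat ->
    (Cmod (ctanh (h + RtoC beta * x n) - x n) < eps)%R) ->
  exists M, (0 <= Re M)%R /\ ctanh (h + RtoC beta * M) = M /\
  forall eps, (0 < eps)%R -> exists N, forall n, (N <= n)%nat -> (Cmod (x n - M) < eps)%R.
Proof.
intros hb hh [N0 h0] hx.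
assert (hK : (0 <= K)%R) by (destruct (h0 N0 (Nat.le_refl _)) as [_ b];
  pose proof (Cmod_ge_0 (x N0)); lra).
assert (hpos : (0 < Re h + beta * K)%R) by nra.
set (lam := (Re h / (2 * (Re h + beta * K)))%R).
assert (hlam : (0 < lam)%R) by (apply Rdiv_lt_0_compat; lra).
destruct (Cmod_Cauchy_complete x) as [M hM].
{ intros eps he.
  (* The first bound meets the smallness hypothesis of [mean_field_stable]; the second makes the sum
     of two defects less than lam eps. *)
  set (eta := Rmin (Re h / (2 * beta)) (lam * eps / 2)).
  assert (heta : (0 < eta)%R) by (apply Rmin_pos; [apply Rdiv_lt_0_compat; lra|nra]).
  assert (heta1 : (beta * eta <= Re h / 2)%R).
  { apply Rle_trans with (beta * (Re h / (2 * beta)))%R; [|right; field; lra].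
    apply Rmult_le_compat_l; [lra|apply Rmin_l]. }
  assert (heta2 : (eta <= lam * eps / 2)%R) by apply Rmin_r.
  destruct (hx eta heta) as [N hN].
  exists (max N N0); intros n p hn hp.
  destruct (h0 n) as [a1 a2]; [lia|]; destruct (h0 p) as [b1 b2]; [lia|].
  specialize (hN n ltac:(lia)) as c1; specialize (hN p ltac:(lia)) as c2.
  pose proof (mean_field_stable beta K h (x n) (x p) hb hh a1 b1 a2 b2) as s; cbv zeta in s.
  specialize (s ltac:(nra) ltac:(nra)); fold lam in s.
  apply Rmult_lt_reg_l with lam; [exact hlam|lra]. }
assert (hRe : (0 <= Re M)%R).
{ destruct (Rle_or_lt 0 (Re M)) as [|neg]; [assumption|exfalso].
  destruct (hM (- Re M)%R) as [N hN]; [lra|].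
  destruct (h0 (max N N0)) as [a1 _]; [lia|].
  specialize (hN (max N N0) ltac:(lia)).
  pose proof (re_le_Cmod (x (max N N0) - M)) as r.
  change (Re (x (max N N0) - M)) with (Re (x (max N N0)) - Re M)%R in r.
  pose proof (Rle_abs (Re (x (max N N0)) - Re M)); lra. }
exists M; split; [exact hRe|split; [|exact hM]].
assert (hy : (0 < Re (h + RtoC beta * M))%R) by (rewrite Re_plus, Re_scal; nra).
destruct (ctanh_cderive _ hy) as [l hl].
assert (hd : is_cderive (fun M => ctanh (h + RtoC beta * M)) M (RtoC beta * l))
  by (apply (is_cderive_comp ctanh (fun M => h + RtoC beta * M));
      [exact hl|apply field_cderive]).
assert (z : Cmod (ctanh (h + RtoC beta * M) - M) = 0%R).
{ apply Rle_antisym; [|apply Cmod_ge_0].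
  apply le_epsilon; intros eps he; rewrite Rplus_0_l.
  destruct (cderive_continuous _ _ _ hd (eps / 3)%R ltac:(lra)) as [d [hd0 H]].
  destruct (hM (Rmin d (eps / 3))) as [N1 h1]; [apply Rmin_pos; lra|].
  destruct (hx (eps / 3)%R ltac:(lra)) as [N2 h2].
  specialize (h1 (max N1 N2) ltac:(lia)); specialize (h2 (max N1 N2) ltac:(lia)).
  set (y := x (max N1 N2)) in *.
  specialize (H y (Rlt_le_trans _ _ _ h1 (Rmin_l _ _))).
  pose proof (Rlt_le_trans _ _ _ h1 (Rmin_r _ _)) as h3.
  replace (ctanh (h + beta * M) - M) with
    ((ctanh (h + beta * y) - y) - (ctanh (h + beta * y) - ctanh (h + beta * M)) + (y - M))
    by ring.
  eapply Rle_trans; [apply Cmod_triangle|].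
  pose proof (Cmod_minus_le (ctanh (h + beta * y) - y)
    (ctanh (h + beta * y) - ctanh (h + beta * M))); lra. }
apply Cmod_eq_0 in z.
transitivity (ctanh (h + beta * M) - M + M); [ring|rewrite z; ring].
Qed.

(** * Identification of the limit through zeta *)

Lemma Ctan_rotated (y : C) : (0 < Re y)%R -> Ctan (Ci * y) = Ci * ctanh y.
Proof.
intros hy; pose proof (one_plus_fugacity_neq_0 y hy) as nz.
unfold Ctan, Csin, Ccos, ctanh, fugacity in *.
replace (- (2 * y)) with (- y + - y) in * by ring; rewrite Cexp_plus in *.
assert (ii : Ci * Ci = -1) by (apply Ceq; simpl; ring).
replace (Ci * (Ci * y)) with (- y) by (rewrite Cmult_assoc, ii; ring).
rewrite (Cexp_opp (- y)).
pose proof (Cexp_neq_0 (- y)) as n0; set (c := Cexp (- y)) in *.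
assert (ni : Ci <> 0) by (intros e; apply (f_equal snd) in e; simpl in e; lra).
assert (n2 : RtoC 2 <> 0) by (intros e; apply RtoC_inj in e; lra).
transitivity (/ Ci * (c * c - 1) / (1 + c * c)).
- field; repeat split; assumption.
- assert (ei : / Ci = - Ci).
  { apply (Cmult_cancel_l Ci); [exact ni|]; rewrite Cinv_r by exact ni.
    transitivity (- (Ci * Ci)); [rewrite ii; ring|ring]. }
  rewrite ei; field; exact nz.
Qed.

Lemma is_zeta_rotated (t : R) (h y : C) :
  is_zeta t (Ci * h) (Ci * y) <-> (0 < Re y)%R /\ y = h + RtoC t * ctanh y.
Proof.
assert (ni : Ci <> 0) by (intros e; apply (f_equal snd) in e; simpl in e; lra).
assert (im : Im (Ci * y) = Re y) by (destruct y; simpl; ring).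
unfold is_zeta; rewrite im; split; intros [hy e]; (split; [exact hy|]);
  rewrite ?Ctan_rotated in * by exact hy.
- apply (Cmult_cancel_l Ci); [exact ni|].
  rewrite Cmult_plus_distr_l, <- e; ring.
- apply (f_equal (Cmult Ci)) in e; rewrite e at 1; ring.
Qed.

(** The fixed point M supplies a solution, so [epsilon] returns some solution i y. Both M and tanh y
    solve the mean-field equation exactly, and stability with zero defects makes them equal. *)
Lemma zeta_rotated (beta : R) (h M : C) : (0 < beta)%R -> (0 < Re h)%R -> (0 <= Re M)%R ->
  ctanh (h + RtoC beta * M) = M -> zeta beta (Ci * h) = Ci * (h + RtoC beta * M).
Proof.
intros hb hh hM e.
assert (ex : is_zeta beta (Ci * h) (zeta beta (Ci * h))).
{ unfold zeta; apply epsilon_spec; exists (Ci * (h + RtoC beta * M)).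
  apply is_zeta_rotated; rewrite e; split; [|reflexivity].
  rewrite Re_plus, Re_scal; nra. }
set (z := zeta beta (Ci * h)) in *.
assert (ii : Ci * Ci = -1) by (apply Ceq; simpl; ring).
assert (ez : z = Ci * (- Ci * z)) by (transitivity (- (Ci * Ci) * z); [rewrite ii|]; ring).
rewrite ez in ex |- *; set (y := - Ci * z) in *.
apply is_zeta_rotated in ex; destruct ex as [hy ey].
pose proof (Re_ctanh_ge_0 y hy) as r2.
pose proof (mean_field_stable beta (Rmax (Cmod M) (Cmod (ctanh y))) h M (ctanh y) hb hh hM r2
  (Rmax_l _ _) (Rmax_r _ _)) as s.
cbv zeta in s; rewrite e, <- ey in s.
replace (M - M) with (RtoC 0) in s by ring.
replace (ctanh y - ctanh y) with (RtoC 0) in s by ring.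
rewrite Cmod_0 in s; specialize (s ltac:(lra) ltac:(lra)).
assert (z0 : Cmod (M - ctanh y) = 0%R).
{ assert (hK : (0 <= Rmax (Cmod M) (Cmod (ctanh y)))%R)
    by (eapply Rle_trans; [apply Cmod_ge_0|apply Rmax_l]).
  assert (hp : (0 < Re h + beta * Rmax (Cmod M) (Cmod (ctanh y)))%R) by nra.
  assert (hl : (0 < Re h / (2 * (Re h + beta * Rmax (Cmod M) (Cmod (ctanh y)))))%R)
    by (apply Rdiv_lt_0_compat; lra).
  pose proof (Cmod_ge_0 (M - ctanh y)); nra. }
apply Cmod_eq_0 in z0.
assert (eM : M = ctanh y) by (transitivity (M - ctanh y + ctanh y); [ring|rewrite z0; ring]).
rewrite eM, <- ey; reflexivity.
Qed.

(** At a fixed point 1 - M = 2E/(1 + E) = 2/(1 + 1/E), with E = e^(2iz); this produces the last term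
    of the stated limit. *)
Lemma free_energy_eq (beta : R) (h M : C) : (0 < Re (h + RtoC beta * M))%R ->
  ctanh (h + RtoC beta * M) = M ->
  let z := Ci * (h + RtoC beta * M) in
  RtoC (beta / 2) + h + Clog (1 + Cexp (2 * Ci * z))
    - RtoC (2 * beta) / (1 + Cexp (- (2 * Ci * z))) ^ 2 = free_energy beta h M.
Proof.
intros hy e z; unfold free_energy.
pose proof (one_plus_fugacity_neq_0 _ hy) as nz.
assert (ii : Ci * Ci = -1) by (apply Ceq; simpl; ring).
assert (ez : 2 * Ci * z = - (2 * (h + beta * M)))
  by (unfold z; transitivity (2 * (Ci * Ci) * (h + beta * M)); [ring|rewrite ii; ring]).
rewrite Cexp_opp, ez; fold (fugacity (h + beta * M)); unfold ctanh in e.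
pose proof (Cexp_neq_0 (- (2 * (h + beta * M)))) as n0; fold (fugacity (h + beta * M)) in n0.
set (E := fugacity (h + beta * M)) in *.
rewrite <- e; simpl Cpow.
replace (RtoC (2 * beta)) with (4 * RtoC (beta / 2)) by (rewrite <- RtoC_mult; f_equal; field).
field; repeat split; try assumption; rewrite Cplus_comm; exact nz.
Qed.

(** [F] stands for either of h -> Z_n(beta, h) and h -> Z_n(beta, -h), equal pointwise but distinct
    as functions given to [log_branch]. *)
Lemma log_branch_free_energy (beta : R) (h : C) (F : nat -> C -> C) :
  (0 < beta)%R -> (0 < Re h)%R ->
  (forall n k, F n k = spin_pf n (beta / INR n) k) ->
  let z := zeta beta (Ci * h) in
  filterlim (fun n : nat => RtoC (/ INR n) * log_branch (F n) h) eventually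
    (locally (RtoC (beta / 2) + h + Clog (1 + Cexp (2 * Ci * z))
      - RtoC (2 * beta) / (1 + Cexp (- (2 * Ci * z))) ^ 2)).
Proof.
intros hb hh hF z.
destruct (finite_size beta (Re h) hb hh) as [K [L [hL fs]]].
assert (small : forall eta, (0 < eta)%R -> exists N, forall n, (N <= n)%nat ->
  (2 <= n)%nat /\ (0 < beta / INR n <= eta)%R).
{ intros eta he; destruct (INR_unbounded (beta / eta)) as [N hN].
  exists (max 2 N); intros n hn; split; [lia|].
  assert (h1 : (INR N <= INR n)%R) by (apply le_INR; lia).
  assert (h2 : (0 < beta / eta)%R) by (apply Rdiv_lt_0_compat; lra).
  split; [apply Rdiv_lt_0_compat; lra|].
  apply Rmult_le_reg_r with (INR n / eta)%R; [apply Rdiv_lt_0_compat; lra|].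
  replace (beta / INR n * (INR n / eta))%R with (beta / eta)%R by (field; lra).
  replace (eta * (INR n / eta))%R with (INR n) by (field; lra); lra. }
set (x := fun n => mean_mag n (beta / INR n) h).
assert (data : exists N0, forall n, (N0 <= n)%nat ->
  (0 <= Re (x n))%R /\ (Cmod (x n) <= K)%R /\
  (Cmod (ctanh (h + RtoC beta * x n) - x n) <= beta / INR n * L)%R /\
  forall T, (0 < T)%R -> (exp (- (2 * (Re h + T))) <= 1 / 2)%R ->
  (Cmod (RtoC (/ INR n) * log_branch (F n) h - free_energy beta h (x n))
    <= T * (beta / INR n * L) + (4 + 8 * beta) * exp (- (2 * (Re h + T))))%R).
{ destruct (small (Re h / 2)%R ltac:(lra)) as [N0 hN0]; exists N0; intros n hn.
  destruct (hN0 n hn) as [n2 [j1 j2]].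
  destruct (lee_yang n (beta / INR n) j1) as [u hu].
  unfold x; rewrite (mean_mag_eq n (beta / INR n) u h hu hh).
  rewrite (log_branch_eq (F n) (log_pf n (beta / INR n) u) h); [| |exact hh].
  - apply (fs n u n2 j2 hu h); lra.
  - intros k hk; rewrite hF; apply (log_pf_is_log_branch n (beta / INR n) u hu k hk). }
destruct data as [N0 data].
destruct (mean_field_limit beta K h x hb hh) as [M [hM [eM lM]]].
{ exists N0; intros n hn; destruct (data n hn) as [d1 [d2 _]]; split; assumption. }
{ intros eps he; destruct (small (eps / (2 * L))%R) as [N1 h1];
    [apply Rdiv_lt_0_compat; lra|].
  exists (max N0 N1); intros n hn; destruct (data n ltac:(lia)) as [_ [_ [d _]]].
  destruct (h1 n ltac:(lia)) as [_ [_ j]].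
  eapply Rle_lt_trans; [exact d|].
  apply Rle_lt_trans with (eps / (2 * L) * L)%R; [apply Rmult_le_compat_r; lra|].
  replace (eps / (2 * L) * L)%R with (eps / 2)%R by (field; lra); lra. }
assert (hy : (0 < Re (h + RtoC beta * M))%R) by (rewrite Re_plus, Re_scal; nra).
unfold z; rewrite (zeta_rotated beta h M hb hh hM eM), (free_energy_eq beta h M hy eM).
apply filterlim_locally; intros eps.
destruct (free_energy_cderive beta h M hy) as [l hl].
assert (he : (0 < eps)%R) by apply cond_pos.
destruct (cderive_continuous _ _ _ hl (eps / 3)%R ltac:(lra)) as [d [hd H]].
destruct (lM d hd) as [N1 h1].
(* T depends on eps alone and makes the tail at most eps/3; [N2] is chosen afterwards. The total is
   below eps/4 + eps/3 + eps/3. *)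
destruct (exp_small (Re h) (Rmin (1 / 2) (eps / 3 / (4 + 8 * beta))) hh) as [T [hT ht]].
{ apply Rmin_pos; [lra|apply Rdiv_lt_0_compat; lra]. }
destruct (small (eps / 4 / (T * L))%R) as [N2 h2].
{ apply Rdiv_lt_0_compat; [lra|apply Rmult_lt_0_compat; lra]. }
exists (max N0 (max N1 N2)); intros n hn.
(* Balls of [C] are products of intervals; a bound on the modulus implies membership. *)
apply C_NormedModule_mixin_compat1.
change (Cmod (RtoC (/ INR n) * log_branch (F n) h - free_energy beta h M) < eps)%R.
destruct (data n ltac:(lia)) as [_ [_ [_ g]]].
specialize (g T hT (Rle_trans _ _ _ ht (Rmin_l _ _))).
specialize (H (x n) (h1 n ltac:(lia))).
destruct (h2 n ltac:(lia)) as [_ [_ j]].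
assert (g1 : (T * (beta / INR n * L) <= eps / 4)%R).
{ apply Rle_trans with (T * (eps / 4 / (T * L) * L))%R; [|right; field; lra].
  apply Rmult_le_compat_l; [lra|]; apply Rmult_le_compat_r; lra. }
assert (g2 : ((4 + 8 * beta) * exp (- (2 * (Re h + T))) <= eps / 3)%R).
{ apply Rle_trans with ((4 + 8 * beta) * (eps / 3 / (4 + 8 * beta)))%R; [|right; field; lra].
  apply Rmult_le_compat_l; [lra|]; eapply Rle_trans; [exact ht|apply Rmin_r]. }
replace (RtoC (/ INR n) * log_branch (F n) h - free_energy beta h M) with
  ((RtoC (/ INR n) * log_branch (F n) h - free_energy beta h (x n))
    + (free_energy beta h (x n) - free_energy beta h M)) by ring.
eapply Rle_lt_trans; [apply Cmod_triangle|]; lra.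
Qed.

Theorem corollary2p9 (beta : R) (h : C) (hbeta : (0 < beta)%R) (hh : (0 < Re h)%R) :
  let z : C := zeta beta (Ci * h) in
  let l : C :=
    RtoC (beta / 2)%R + h + Clog (1 + Cexp (2 * Ci * z))
    - RtoC (2 * beta)%R / (1 + Cexp (- (2 * Ci * z))) ^ 2 in
  filterlim (fun n : nat => RtoC (/ INR n)%R * log_branch (fun k : C => Zcw n beta k) h)
    eventually (locally l) /\
  filterlim (fun n : nat => RtoC (/ INR n)%R * log_branch (fun k : C => Zcw n beta (- k)) h)
    eventually (locally l).
Proof.
intros z l; split.
- apply (log_branch_free_energy beta h (fun n k => Zcw n beta k) hbeta hh).
  intros n k; apply Zcw_spin_pf.
- apply (log_branch_free_energy beta h (fun n k => Zcw n beta (- k)) hbeta hh).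
  intros n k; rewrite Zcw_even; apply Zcw_spin_pf.
Qed.
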